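(* Let \[ C_{\mathrm{pos}}=\frac{5\cdot 3^{4/5}}{\pi^{7/5}}+\frac{\sqrt2}{\pi^{1/4}}\approx 3.48695 . \] Then for every dimension $d=2^m$ ($m\ge1$ an integer), \[ \sup_{u\in S^{d-1}}\ \sup_{1\le k\le d}\ \mathrm{K}\bigl([T(u)]_k,[X(u)]_k\bigr)\le C_{\mathrm{pos}}\,d^{-1/5}. \]
   Context: $S^{d-1}$ is the unit sphere in $\mathbb{R}^d$. $H$ is the unnormalized $d\times d$ Walsh--Hadamard matrix ($H_1=(1)$, $H_{2n}=\begin{pmatrix}H_n&H_n\\H_n&-H_n\end{pmatrix}$). $D^{(1)},D^{(2)}$ are independent diagonal matrices with i.i.d. Rademacher diagonal entries. For deterministic $u\in S^{d-1}$, $T(u)=\frac1d HD^{(1)}HD^{(2)}u$, and $X(u)=Ru$ where $R$ is Haar-distributed on the orthogonal group $\mathcal O(d)$ (so $X(u)$ is uniform on $S^{d-1}$). $[v]_k$ is the $k$th coordinate. For real random variables $A,B$, $\mathrm{K}(A,B)=\sup_{t\in\mathbb{R}}|\mathbb{P}(A\le t)-\mathbb{P}(B\le t)|$ is the Kolmogorov distance. *)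

(* Defs.v *)
From HB Require Import structures.
From mathcomp Require Import all_boot all_order all_algebra.
From mathcomp Require Import all_classical all_reals all_analysis.
Set Implicit Arguments. Unset Strict Implicit. Unset Printing Implicit Defensive.
Import Order.TTheory GRing.Theory Num.Theory.
Local Open Scope classical_set_scope.
Local Open Scope ring_scope.

Section Defs.
Variable R : realType.

(* Unnormalized Walsh--Hadamard matrix H_{2^m}, entrywise, following the
   recursion H_1 = (1), H_{2n} = [[H_n, H_n], [H_n, -H_n]] with n = 2^m. *)
Fixpoint had (m : nat) (i j : nat) : R :=
  match m with
  | 0 => 1
  | m'.+1 =>
      let n := (2 ^ m')%N in
      if (i < n)%N then
        (if (j < n)%N then had m' i j else had m' i (j - n))
      else
        (if (j < n)%N then had m' (i - n) j else - had m' (i - n) (j - n))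
  end.

Definition hadamard (m : nat) : 'M[R]_(2 ^ m) :=
  \matrix_(i, j) had m i j.

Definition rad_diag n (s : {ffun 'I_n -> bool}) : 'M[R]_n :=
  diag_mx (\row_i ((-1) ^+ s i)).

Definition Tvec (m : nat) (s1 s2 : {ffun 'I_(2 ^ m) -> bool})
    (u : 'cV[R]_(2 ^ m)) : 'cV[R]_(2 ^ m) :=
  ((2 ^ m)%:R)^-1 *: (hadamard m *m rad_diag s1 *m hadamard m *m rad_diag s2 *m u).

(* CDF of [T(u)]_k: D1, D2 independent with i.i.d. Rademacher entries, i.e.
   (s1, s2) uniform on the 2^d * 2^d sign patterns. *)
Definition cdf_T (m : nat) (u : 'cV[R]_(2 ^ m)) (k : 'I_(2 ^ m)) (t : R) : R :=
  #|[set s : {ffun 'I_(2 ^ m) -> bool} * {ffun 'I_(2 ^ m) -> bool}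
      | Tvec s.1 s.2 u k ord0 <= t]|%:R
  / (#|{ffun 'I_(2 ^ m) -> bool}| * #|{ffun 'I_(2 ^ m) -> bool}|)%:R.

(* n-dimensional Lebesgue integral of a nonnegative extended-real function on
   R^n (row vectors), as an iterated integral against Lebesgue measure on R. *)
Fixpoint iint (n : nat) : ('rV[R]_n -> \bar R) -> \bar R :=
  match n return ('rV[R]_n -> \bar R) -> \bar R with
  | 0 => fun f => f 0
  | n'.+1 => fun f =>
      (\int[lebesgue_measure]_x iint (fun v : 'rV[R]_n' =>
           f (row_mx (\row_(_ < 1) x) v)))%E
  end.

Definition vol n (A : set 'rV[R]_n) : \bar R := iint (fun x => (\1_A x)%:E).

Definition sqnorm n (x : 'rV[R]_n) : R := \sum_i x ord0 i ^+ 2.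

Definition unit_ball n : set 'rV[R]_n := [set x | sqnorm x <= 1].

(* Normalized (uniform) surface measure on S^{n-1}:
   sigma(A) = vol({r a : a in A, 0 < r <= 1}) / vol(unit ball). *)
Definition sphere_unif n (A : set 'rV[R]_n) : R :=
  fine (vol [set x | x != 0 /\ sqnorm x <= 1
                     /\ A ((Num.sqrt (sqnorm x))^-1 *: x)])
  / fine (vol (@unit_ball n)).

(* CDF of [X(u)]_k where X(u) = R u is uniform on S^{d-1}. *)
Definition cdf_X n (k : 'I_n) (t : R) : R :=
  sphere_unif [set y : 'rV[R]_n | y ord0 k <= t].

Definition kolmogorov (F G : R -> R) : R :=
  sup [set `|F t - G t| | t in [set: R]].

Definition on_sphere n (u : 'cV[R]_n) : Prop := \sum_i u i ord0 ^+ 2 = 1.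

Definition C_pos : R :=
  5 * powR 3 (4 / 5) / powR pi (7 / 5) + Num.sqrt 2 / powR pi (1 / 4).

End Defs.

(* Main.v *)
Require Import Defs.
From HB Require Import structures.
From mathcomp Require Import all_boot all_order all_algebra.
From mathcomp Require Import all_classical all_reals all_analysis.
From mathcomp Require Import measurable_realfun ring lra.
Set Implicit Arguments.
Unset Strict Implicit.
Import Order.TTheory GRing.Theory Num.Theory.
Import numFieldNormedType.Exports.
Local Open Scope classical_set_scope.
Local Open Scope ring_scope.

(** Conditionally on the second sign vector, [sqrt d * T(u)_k] is a Rademacher
   sum [S = sum_j e_j b_j] with [sum_j b_j^2 = 1], and averaging over the second
   sign vector gives [E sum_j b_j^4 <= 3 / d].  The indicator of a half-line is
   convolved with a cubic B-spline of step [w]; the heat flow of the result is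
   the fourth difference (divided by [w^4]) of an explicit fourth antiderivative
   of [y |-> Phi (y / r)], so that replacing one Rademacher term by a Gaussian one of the
   same variance costs only [b_j^4 / (4 w^4)].  With [w = d^(-1/5)] this compares
   [S] with the standard normal law up to [O(d^(-1/5))].

   On the sphere, the cone [x_k <= t |x|] differs from the slab [x_k <= t] inside
   the unit ball by a small volume, and the marginal of the ball has density
   proportional to [(1 - s^2)^((d-1)/2)], squeezed between
   [exp (- (d-1) s^2 / 2)] and the same with a factor [1 - (d-1) s^4]; hence it is
   normal up to [O(1/d)].  All errors add up to at most [3 d^(-1/5)] when
   [d >= 512], while the claimed bound exceeds [1] when [d <= 256]. *)
(** * Differential calculus and the Gaussian distribution function *)

(** The exponent 1/5 balances the smoothing error, of order [w], against the accumulated replacement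
    cost, of order [1 / (d w^4)]. The cost per term is of fourth order because odd terms cancel by
    symmetry of the signs and second-order terms because the variances agree; hence a test function
    with bounded fourth derivative is required. The bound has to be linear in [sum_j b_j^4]: for an
    unlucky second sign vector this sum can be of order one, only its mean is small, and a linear
    bound can be averaged. Closed forms in the normal distribution function replace convolution
    integrals by derivatives. The price is that the Gaussian radius must stay positive, so a
    residual Gaussian of variance [eps] survives to the end and is removed by a Chebyshev bound. On
    the sphere no Gamma function enters: the distribution function is a quotient of two values of
    the same primitive, and each is compared with the normal law after the same rescaling. *)

Section derivatives.
Variable R : realType.
Implicit Types (f g : R -> R) (x y z a b c : R).

Lemma is_derive_add f g x a b : is_derive x 1 f a -> is_derive x 1 g b ->
  is_derive x 1 (fun y => f y + g y) (a + b).
Proof. by move=> ? ?; exact: is_deriveD. Qed.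

Lemma is_derive_sub f g x a b : is_derive x 1 f a -> is_derive x 1 g b ->
  is_derive x 1 (fun y => f y - g y) (a - b).
Proof. by move=> ? ?; exact: is_deriveB. Qed.

Lemma is_derive_opp f x a : is_derive x 1 f a ->
  is_derive x 1 (fun y => - f y) (- a).
Proof. by move=> ?; exact: is_deriveN. Qed.

Lemma is_derive_mul f g x a b : is_derive x 1 f a -> is_derive x 1 g b ->
  is_derive x 1 (fun y => f y * g y) (f x * b + g x * a).
Proof. by move=> ? ?; exact: is_deriveM. Qed.

Lemma is_derive_pow f n x a : is_derive x 1 f a ->
  is_derive x 1 (fun y => f y ^+ n) (n%:R * f x ^+ n.-1 * a).
Proof.
move=> h; have -> : (fun y => f y ^+ n) = f ^+ n by apply/funext => y; rewrite fctE.
exact: is_deriveX.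
Qed.

Lemma is_derive_comp f g x a b : is_derive x 1 g b -> is_derive (g x) 1 f a ->
  is_derive x 1 (fun y => f (g y)) (a * b).
Proof. by move=> ? ?; exact: is_derive1_comp. Qed.

Lemma is_derive_inv f x a : f x != 0 -> is_derive x 1 f a ->
  is_derive x 1 (fun y => (f y)^-1) (- (f x) ^- 2 * a).
Proof. by move=> ? ?; exact: is_deriveV. Qed.

Lemma is_derive_const c x : is_derive x 1 (fun _ : R => c) 0.
Proof. exact: is_derive_cst. Qed.

Lemma is_derive_idfun x : is_derive x 1 (fun y : R => y) 1.
Proof. exact: is_derive_id. Qed.

Lemma is_derive_sqrt x : 0 < x -> is_derive x 1 Num.sqrt ((2 * Num.sqrt x)^-1).
Proof.
move=> x0; have s0 : 0 < Num.sqrt x by rewrite sqrtr_gt0.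
have {1}-> : x = Num.sqrt x ^+ 2 by rewrite sqr_sqrtr// ltW.
apply: (@is_derive_inverse _ (fun y : R => y ^+ 2)).
- near=> y; rewrite sqrtr_sqr gtr0_norm//.
  by near: y; exact: lt_nbhsr.
- by near=> y; exact: exprn_continuous.
- have := is_derive_pow 2 (is_derive_idfun (Num.sqrt x)).
  by rewrite /= expr1 mulr1.
- by rewrite mulf_neq0// gt_eqF.
Unshelve. all: by end_near. Qed.


Lemma derive_ndecr (f df : R -> R) a b : a <= b ->
  (forall x, a <= x -> x <= b -> is_derive x 1 f (df x)) ->
  (forall x, a < x -> x < b -> 0 <= df x) -> f a <= f b.
Proof.
rewrite le_eqVlt => /predU1P[->//|ab] fd d0.
rewrite -subr_ge0; have [||c] := @MVT _ f df _ _ ab.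
- by move=> x /[!in_itv]/= /andP[ax xb]; apply: fd; exact: ltW.
- apply: derivable_within_continuous => x /[!in_itv]/= /andP[ax xb].
  by have [] := fd x ax xb.
rewrite in_itv/= => /andP[ac cb] ->.
by rewrite mulr_ge0 ?d0// subr_ge0 ltW.
Qed.

(** Together with [derive_norm_le] this does the work of integration: instead of estimating an
    integral, compare the integrand with the derivative of an explicit function. The Taylor bounds,
    the trapezoid rule and the comparison of densities are all obtained in this way. *)
Lemma derive_le (f df g dg : R -> R) a b : a <= b ->
  (forall x, a <= x -> x <= b -> is_derive x 1 f (df x)) ->
  (forall x, a <= x -> x <= b -> is_derive x 1 g (dg x)) ->
  (forall x, a < x -> x < b -> df x <= dg x) -> f b - f a <= g b - g a.
Proof.
move=> ab fd gd fg.
have : g a - f a <= g b - f b.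
  apply: (@derive_ndecr (fun x => g x - f x) (fun x => dg x - df x)) => //.
    by move=> x ax xb; apply: is_derive_sub; [exact: gd|exact: fd].
  by move=> x ax xb; rewrite subr_ge0 fg.
lra.
Qed.

Lemma derive_norm_le (f df g dg : R -> R) a b : a <= b ->
  (forall x, a <= x -> x <= b -> is_derive x 1 f (df x)) ->
  (forall x, a <= x -> x <= b -> is_derive x 1 g (dg x)) ->
  (forall x, a < x -> x < b -> `|df x| <= dg x) -> `|f b - f a| <= g b - g a.
Proof.
move=> ab fd gd fg; rewrite ler_norml; apply/andP; split.
  have := @derive_le (fun x => - f x) (fun x => - df x) g dg a b ab.
  have H : forall x, a < x -> x < b -> - df x <= dg x.
    by move=> x ax xb; have := fg x ax xb; rewrite ler_norml; lra.
  move=> /(_ (fun x ax xb => is_derive_opp (fd x ax xb)) gd H); lra.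
apply: (@derive_le f df g dg) => // x ax xb.
by apply: le_trans (fg x ax xb); exact: ler_norm.
Qed.

Lemma increment_bounds (f g : R -> R) (y w lo hi : R) : 0 <= w ->
  (forall z, is_derive z 1 f (g z)) ->
  (forall z, y <= z -> z <= y + w -> lo <= g z <= hi) ->
  w * lo <= f (y + w) - f y <= w * hi.
Proof.
move=> w0 fg lh; have yw : y <= y + w by rewrite lerDl.
have D c z : is_derive z 1 (fun z => c * z) c.
  apply: is_derive_eq (is_derive_mul (is_derive_const c z) (is_derive_idfun z)) _.
  by rewrite mulr1 mulr0 addr0.
apply/andP; split.
- have := @derive_le (fun z => lo * z) (fun=> lo) f g y (y + w) yw
    (fun z _ _ => D lo z) (fun z _ _ => fg z).
  move=> H; have : lo * (y + w) - lo * y <= f (y + w) - f y.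
    by apply: H => z yz zw; have /andP[] := lh z (ltW yz) (ltW zw).
  lra.
- have := @derive_le f g (fun z => hi * z) (fun=> hi) y (y + w) yw
    (fun z _ _ => fg z) (fun z _ _ => D hi z).
  move=> H; have : f (y + w) - f y <= hi * (y + w) - hi * y.
    by apply: H => z yz zw; have /andP[] := lh z (ltW yz) (ltW zw).
  lra.
Qed.

End derivatives.

Section gaussian.
Variable R : realType.
Implicit Types (x y z r s : R).

Definition gauss_pdf z : R := normal_peak 1 * expR (- (z ^+ 2 / 2)).

Definition Phi x : R := \int[lebesgue_measure]_(t in `]-oo, x]) gauss_pdf t.

Lemma gauss_pdfE : gauss_pdf = normal_pdf 0 1.
Proof.
apply/funext => z; rewrite normal_pdfE ?oner_neq0// /gauss_pdf /normal_fun.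
by rewrite subr0 expr1n mulNr.
Qed.

Lemma gauss_pdf_gt0 z : 0 < gauss_pdf z.
Proof. by rewrite mulr_gt0 ?expR_gt0// normal_peak_gt0 ?oner_neq0. Qed.

Lemma gauss_pdf_le z : gauss_pdf z <= normal_peak 1.
Proof. by rewrite gauss_pdfE normal_pdf_ub ?oner_neq0. Qed.

Lemma gauss_pdfN z : gauss_pdf (- z) = gauss_pdf z.
Proof. by rewrite /gauss_pdf sqrrN. Qed.

Lemma integrable_gauss_pdf (A : set R) : measurable A ->
  lebesgue_measure.-integrable A (EFin \o gauss_pdf).
Proof.
move=> mA; rewrite gauss_pdfE; apply: (@integrableS _ _ _ _ setT) => //.
exact: integrable_normal_pdf.
Qed.

Lemma is_derive_Phi x : is_derive x 1 Phi (gauss_pdf x).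
Proof.
have x1 : x < x + 1 by rewrite ltrDl.
have [|//||d1 d2] := @continuous_FTC1 R gauss_pdf -oo%O x (x + 1) x1.
- exact: integrable_gauss_pdf.
- exact: ltNyr.
- by rewrite gauss_pdfE; apply: continuous_normal_pdf; rewrite oner_neq0.
by split; [exact: d1|rewrite -derive1E; exact: d2].
Qed.

Lemma is_derive_gauss_pdf x : is_derive x 1 gauss_pdf (- x * gauss_pdf x).
Proof.
have H : is_derive x 1 (fun z => - (z ^+ 2 / 2)) (- x).
  apply: is_derive_eq (is_derive_opp (is_derive_mul (is_derive_pow 2 (is_derive_idfun x)) (is_derive_const 2^-1 x))) _.
  by rewrite /= expr1; field.
apply: is_derive_eq (is_derive_mul (is_derive_const (normal_peak 1) x)
  (is_derive_comp H (is_derive_expR _))) _.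
by rewrite /gauss_pdf; ring.
Qed.

Lemma Phi_homo x y : x <= y -> Phi x <= Phi y.
Proof.
move=> xy; apply: (@derive_ndecr _ Phi gauss_pdf) => //.
  by move=> z _ _; exact: is_derive_Phi.
by move=> z _ _; exact/ltW/gauss_pdf_gt0.
Qed.

Lemma Phi_lip x y : x <= y -> Phi y - Phi x <= normal_peak 1 * (y - x).
Proof.
move=> xy; have /andP[_] : (y - x) * 0 <= Phi (x + (y - x)) - Phi x <= (y - x) * normal_peak 1.
  apply: (@increment_bounds _ Phi gauss_pdf).
  - by rewrite subr_ge0.
  - by move=> z; exact: is_derive_Phi.
  - by move=> z _ _; rewrite gauss_pdf_le ltW ?gauss_pdf_gt0.
by rewrite subrKC mulrC.
Qed.

Lemma Phi_prob x : Phi x = fine (normal_prob 0 1 `]-oo, x]).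
Proof. by rewrite /Phi /Rintegral gauss_pdfE. Qed.

Lemma Phi_ge0 x : 0 <= Phi x.
Proof. by rewrite Phi_prob fine_ge0. Qed.

Lemma Phi_le1 x : Phi x <= 1.
Proof.
rewrite Phi_prob -lee_fin fineK ?fin_num_measure//.
exact: probability_le1.
Qed.

(** The identity viewed as a random variable under the normal law, so that the limits of [cdf] at
    infinity carry over to [Phi]. *)
Let idR : measurableTypeR R -> R := idfun.

#[local] HB.instance Definition _ :=
  @isMeasurableFun.Build _ _ _ _ idR (@measurable_id _ _ setT).

Lemma Phi_cdf x : Phi x = fine (cdf (idR : {RV (normal_prob (0 : R) 1) >-> R}) x).
Proof. by rewrite Phi_prob. Qed.

Lemma cvg_Phiy : Phi x @[x --> +oo] --> (1 : R).
Proof.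
rewrite (_ : Phi = fine \o cdf (idR : {RV (normal_prob (0 : R) 1) >-> R})).
  by apply: fine_cvg; exact: cvg_cdfy1.
by apply/funext => x; exact: Phi_cdf.
Qed.

Lemma cvg_PhiNy : Phi x @[x --> -oo] --> (0 : R).
Proof.
rewrite (_ : Phi = fine \o cdf (idR : {RV (normal_prob (0 : R) 1) >-> R})).
  by apply: fine_cvg; exact: cvg_cdfNy0.
by apply/funext => x; exact: Phi_cdf.
Qed.

(** The sum [Phi y + Phi (- y)] has derivative zero because the density is even, and its limit at
    infinity is 1. *)
Lemma PhiN x : Phi (- x) = 1 - Phi x.
Proof.
have cst y : Phi y + Phi (- y) = Phi x + Phi (- x).
  apply: (@is_derive_0_is_cst R (fun y => Phi y + Phi (- y))) => {}y.
  apply: is_derive_eq (is_derive_add (is_derive_Phi y) (is_derive_comp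
    (is_derive_opp (is_derive_idfun y)) (is_derive_Phi (- y)))) _.
  by rewrite gauss_pdfN; ring.
have c1 : (Phi y + Phi (- y)) @[y --> +oo] --> (1 + 0 : R).
  apply: cvgD; first exact: cvg_Phiy.
  by have /cvgNy_compNP := cvg_PhiNy.
have c2 : (Phi y + Phi (- y)) @[y --> +oo] --> Phi x + Phi (- x).
  by rewrite (_ : (fun y => _) = fun=> Phi x + Phi (- x)); [exact: cvg_cst|apply/funext => y; exact: cst].
have H : (1 + 0 : R) = Phi x + Phi (- x) := cvg_unique (@Rhausdorff R) c1 c2.
by rewrite -[1 in RHS]addr0 H addrC addKr.
Qed.

(** A Chebyshev tail bound: on the positive reals [Phi y + y ^- 2] is nonincreasing with limit 1, so
    it never falls below 1. *)
Lemma Phi_ge z : 0 < z -> 1 - z ^- 2 <= Phi z.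
Proof.
move=> z0; rewrite leNgt; apply/negP => Pz.
pose h y := - (Phi y + y ^- 2).
have hd y : 0 < y -> is_derive y 1 h (2 * y ^- 3 - gauss_pdf y).
  move=> y0; have yn : y ^+ 2 != 0 by rewrite expf_neq0 ?gt_eqF.
  apply: is_derive_eq (is_derive_opp (is_derive_add (is_derive_Phi y)
    (@is_derive_inv _ (fun y => y ^+ 2) y _ yn (is_derive_pow 2 (is_derive_idfun y))))) _.
  by rewrite /= expr1; field; rewrite gt_eqF.
have dge0 y : 0 < y -> 0 <= 2 * y ^- 3 - gauss_pdf y.
  move=> y0; rewrite subr_ge0 /gauss_pdf.
  have pk : normal_peak (1 : R) <= 2^-1.
    rewrite /normal_peak expr1n mul1r lef_pV2 ?posrE ?sqrtr_gt0//; last first.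
      by rewrite pmulrn_rgt0// pi_gt0.
    rewrite -(@ler_pXn2r _ 2)// ?nnegrE ?sqrtr_ge0// sqr_sqrtr.
      by have := pi_ge2 R; rewrite -mulr_natr; lra.
    by rewrite mulrn_wge0// pi_ge0.
  (* With the peak at most 1/2, the sign of the derivative reduces to [y^3 / 2 <= 2 + y^4 / 4]; the
     quadratic term of the exponential series is enough for that. *)
  have e1 := @expR_ge1Dxn R (y ^+ 2 / 2) 1 (divr_ge0 (sqr_ge0 y) (ler0n _ 2)).
  rewrite expRN ler_pdivlMr ?exprn_gt0//.
  rewrite mulrAC ler_pdivrMr ?expR_gt0 //.
  have p0 : 0 < normal_peak (1 : R) by rewrite normal_peak_gt0// oner_neq0.
  apply: (@le_trans _ _ (2^-1 * y ^+ 3)); first by rewrite ler_pM2r ?exprn_gt0.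
  apply: (@le_trans _ _ (2 * (1 + (y ^+ 2 / 2) ^+ 2 / 2`!%:R))); last first.
    by rewrite ler_pM2l.
  rewrite (_ : 2`!%:R = 2 :> R)//.
  nra.
have hz y : z <= y -> h z <= h y.
  move=> zy; apply: (derive_ndecr zy (df := fun y => 2 * y ^- 3 - gauss_pdf y)).
    by move=> x zx _; apply: hd; exact: lt_le_trans zx.
  by move=> x zx _; apply: dge0; exact: lt_trans zx.
have e0 : 0 < 1 - z ^- 2 - Phi z by rewrite subr_gt0.
move/cvgrPdist_lt: cvg_Phiy => /(_ _ e0) [M [_ HM]].
pose y := Num.max (M + 1) z.
have /HM : M < y by rewrite lt_max ltrDl ltr01.
have : z <= y by rewrite le_max lexx orbT.
move=> zy; have y0 : 0 < y by exact: lt_le_trans zy.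
have := hz y zy; rewrite /h ltr_norml => h1 /andP[_ h2].
have : 0 < y ^- 2 by rewrite invr_gt0 exprn_gt0.
lra.
Qed.

End gaussian.

(** * Heat polynomials attached to the Gaussian distribution function *)

Section heat.
Variable R : realType.
Implicit Types (x y z r s t w b v : R).

(** With [Z] standard normal, [heat k] is the truncated moment [E[(y + r Z)_+^k] / k!], read as a
    probability for [k = 0]. The recursion is Gaussian integration by parts. *)
Definition heat0 r y : R := Phi (y / r).
Definition heat1 r y : R := y * heat0 r y + r * gauss_pdf (y / r).
Definition heat2 r y : R := (y * heat1 r y + r ^+ 2 * heat0 r y) / 2.
Definition heat3 r y : R := (y * heat2 r y + r ^+ 2 * heat1 r y) / 3.
Definition heat4 r y : R := (y * heat3 r y + r ^+ 2 * heat2 r y) / 4.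

Section path.
Variables (r y : R -> R) (s r' y' : R).
Hypothesis rs : r s != 0.
Hypothesis hr : is_derive s 1 r r'.
Hypothesis hy : is_derive s 1 y y'.

Lemma is_derive_heat0_path : is_derive s 1 (fun t => heat0 (r t) (y t))
  (gauss_pdf (y s / r s) * (y' / r s - y s * r' / r s ^+ 2)).
Proof.
apply: is_derive_eq (is_derive_comp
  (is_derive_mul hy (is_derive_inv rs hr)) (is_derive_Phi (y s / r s))) _.
by field.
Qed.

Lemma is_derive_heat1_path : is_derive s 1 (fun t => heat1 (r t) (y t))
  (y' * heat0 (r s) (y s) + r' * gauss_pdf (y s / r s)).
Proof.
apply: is_derive_eq (is_derive_add (is_derive_mul hy is_derive_heat0_path)
 (is_derive_mul hr (is_derive_comp
  (is_derive_mul hy (is_derive_inv rs hr)) (is_derive_gauss_pdf (y s / r s))))) _.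
by field.
Qed.

(** From here on the formula is uniform: moving [y] goes down one antiderivative, moving [r] goes
    down two with a factor [r]. This is the heat equation in the variable [r^2 / 2], read along a
    path that moves both arguments. *)
Lemma is_derive_heat2_path : is_derive s 1 (fun t => heat2 (r t) (y t))
  (y' * heat1 (r s) (y s) + r s * r' * heat0 (r s) (y s)).
Proof.
apply: is_derive_eq (is_derive_mul (is_derive_add
  (is_derive_mul hy is_derive_heat1_path)
  (is_derive_mul (is_derive_pow 2 hr) is_derive_heat0_path))
  (is_derive_const 2^-1 s)) _.
by rewrite /heat1 /= expr1; field.
Qed.

Lemma is_derive_heat3_path : is_derive s 1 (fun t => heat3 (r t) (y t))
  (y' * heat2 (r s) (y s) + r s * r' * heat1 (r s) (y s)).
Proof.
apply: is_derive_eq (is_derive_mul (is_derive_add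
  (is_derive_mul hy is_derive_heat2_path)
  (is_derive_mul (is_derive_pow 2 hr) is_derive_heat1_path))
  (is_derive_const 3^-1 s)) _.
by rewrite /heat2 /heat1 /= expr1; field.
Qed.

Lemma is_derive_heat4_path : is_derive s 1 (fun t => heat4 (r t) (y t))
  (y' * heat3 (r s) (y s) + r s * r' * heat2 (r s) (y s)).
Proof.
apply: is_derive_eq (is_derive_mul (is_derive_add
  (is_derive_mul hy is_derive_heat3_path)
  (is_derive_mul (is_derive_pow 2 hr) is_derive_heat2_path))
  (is_derive_const 4^-1 s)) _.
by rewrite /heat3 /heat2 /heat1 /= expr1; field.
Qed.

End path.

Section vertical.
Variables (r y : R).
Hypothesis r0 : r != 0.

Let dr := is_derive_const r y.
Let dy := is_derive_idfun y.

Lemma is_derive_heat1 : is_derive y 1 (heat1 r) (heat0 r y).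
Proof. by apply: is_derive_eq (is_derive_heat1_path r0 dr dy) _; ring. Qed.

Lemma is_derive_heat2 : is_derive y 1 (heat2 r) (heat1 r y).
Proof. by apply: is_derive_eq (is_derive_heat2_path r0 dr dy) _; ring. Qed.

Lemma is_derive_heat3 : is_derive y 1 (heat3 r) (heat2 r y).
Proof. by apply: is_derive_eq (is_derive_heat3_path r0 dr dy) _; ring. Qed.

Lemma is_derive_heat4 : is_derive y 1 (heat4 r) (heat3 r y).
Proof. by apply: is_derive_eq (is_derive_heat4_path r0 dr dy) _; ring. Qed.

End vertical.

Definition fdiff w (f : R -> R) y := f (y + w) - f y.
Definition fdiff4 w (f : R -> R) := fdiff w (fdiff w (fdiff w (fdiff w f))).

Lemma is_derive_shift_arg (f : R -> R) a y w :
  is_derive (y + w) 1 f a -> is_derive y 1 (fun z => f (z + w)) a.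
Proof.
move=> h; apply: is_derive_eq (is_derive_comp
  (is_derive_add (is_derive_idfun y) (is_derive_const w y)) h) _.
by ring.
Qed.

Lemma is_derive_fdiff w (f df : R -> R) :
  (forall y, is_derive y 1 f (df y)) ->
  forall y, is_derive y 1 (fdiff w f) (fdiff w df y).
Proof. by move=> h y; apply: is_derive_sub => //; exact: is_derive_shift_arg. Qed.

Lemma is_derive_fdiff4 w (f df : R -> R) :
  (forall y, is_derive y 1 f (df y)) ->
  forall y, is_derive y 1 (fdiff4 w f) (fdiff4 w df y).
Proof. by move=> h; do 4 apply: is_derive_fdiff. Qed.

Lemma fdiff4E w (f : R -> R) y : fdiff4 w f y =
  f (y + w + w + w + w) - 4 * f (y + w + w + w) + 6 * f (y + w + w)
  - 4 * f (y + w) + f y.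
Proof. by rewrite /fdiff4 /fdiff; ring. Qed.

Lemma is_derive_fdiff4_path w (F dF : R -> R -> R) (y : R -> R) s :
  (forall c, is_derive s 1 (fun t => F t (y t + c)) (dF s (y s + c))) ->
  is_derive s 1 (fun t => fdiff4 w (F t) (y t)) (fdiff4 w (dF s) (y s)).
Proof.
move=> h; under eq_fun do rewrite fdiff4E.
rewrite fdiff4E.
have h0 : is_derive s 1 (fun t => F t (y t)) (dF s (y s)).
  by have := h 0; rewrite addr0; under eq_fun do rewrite addr0.
have h' c d : is_derive s 1 (fun t => F t (y t + c + d)) (dF s (y s + c + d)).
  by have := h (c + d); rewrite addrA; under eq_fun do rewrite addrA.
have h2 c d e : is_derive s 1 (fun t => F t (y t + c + d + e)) (dF s (y s + c + d + e)).
  by have := h' c (d + e); rewrite addrA; under eq_fun do rewrite addrA.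
have h3 c d e g : is_derive s 1 (fun t => F t (y t + c + d + e + g)) (dF s (y s + c + d + e + g)).
  by have := h2 c d (e + g); rewrite addrA; under eq_fun do rewrite addrA.
apply: is_derive_eq (is_derive_add (is_derive_sub (is_derive_add (is_derive_sub
 (h3 w w w w) (is_derive_mul (is_derive_const 4 s) (h2 w w w)))
 (is_derive_mul (is_derive_const 6 s) (h' w w)))
 (is_derive_mul (is_derive_const 4 s) (h w))) h0) _.
by ring.
Qed.

Lemma heat0_homo r y z : 0 < r -> y <= z -> heat0 r y <= heat0 r z.
Proof. by move=> r0 yz; apply: Phi_homo; rewrite ler_pM2r ?invr_gt0. Qed.

(** The coefficients 1, -4, 6, -4, 1 have partial sums 1, -3, 3, -1, 0, so summation by parts
    against a monotone function with values in [0, 1] gives 3, where the values alone would give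
    8. *)
Lemma fdiff4_heat0_le w r y : 0 < r -> 0 <= w -> `|fdiff4 w (heat0 r) y| <= 3.
Proof.
move=> r0 w0; rewrite fdiff4E.
have m c : heat0 r c <= heat0 r (c + w) by apply: heat0_homo; rewrite ?lerDl.
have := m y; have := m (y + w); have := m (y + w + w); have := m (y + w + w + w).
have : 0 <= heat0 r y by exact: Phi_ge0.
have : heat0 r (y + w + w + w + w) <= 1 by exact: Phi_le1.
move: (heat0 _ _) (heat0 _ _) (heat0 _ _) (heat0 _ _) (heat0 _ _) => a b c d e.
by move=> *; rewrite ler_norml; apply/andP; split; lra.
Qed.

(** Each difference of an antiderivative is an integral over a window of length [w]; four nested
    windows reach from [y] to [y + 4 w], and monotonicity of [heat0] puts the extreme values at the
    ends. After division by [w^4] this says how far smoothing moves the half-line. *)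
Lemma fdiff4_heat4_bounds w r y : 0 < r -> 0 <= w ->
  w ^+ 4 * heat0 r y <= fdiff4 w (heat4 r) y <= w ^+ 4 * heat0 r (y + 4 * w).
Proof.
move=> r0 w0; have rn : r != 0 by rewrite gt_eqF.
have step k (f g : R -> R) c : (forall z, is_derive z 1 f (g z)) ->
  (forall z, w ^+ k * heat0 r z <= g z <= w ^+ k * heat0 r (z + c)) ->
  forall z, w ^+ k.+1 * heat0 r z <= fdiff w f z <= w ^+ k.+1 * heat0 r (z + (c + w)).
  move=> fg gb z; rewrite exprS -!mulrA; apply: increment_bounds => // x zx xz.
  have /andP[g1 g2] := gb x; have wk : 0 <= w ^+ k by rewrite exprn_ge0.
  apply/andP; split.
    by apply: le_trans g1; rewrite ler_wpM2l// heat0_homo.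
  by apply: le_trans g2 _; rewrite ler_wpM2l// heat0_homo//; lra.
have s1 : forall z, w ^+ 1 * heat0 r z <= fdiff w (heat1 r) z <= w ^+ 1 * heat0 r (z + w).
  move=> z; have := @step 0 (heat1 r) (heat0 r) 0 (fun z => is_derive_heat1 z rn).
  rewrite !add0r; apply => {}z.
  by rewrite expr0 !mul1r addr0 lexx.
have s2 := @step 1 (fdiff w (heat2 r)) (fdiff w (heat1 r)) w
  (is_derive_fdiff w (fun z => is_derive_heat2 z rn)) s1.
have s3 := step 2 (fdiff w (fdiff w (heat3 r))) _ _
  (is_derive_fdiff w (is_derive_fdiff w (fun z => is_derive_heat3 z rn))) s2.
have s4 := step 3 (fdiff w (fdiff w (fdiff w (heat4 r)))) _ _
  (is_derive_fdiff w (is_derive_fdiff w (is_derive_fdiff w (fun z => is_derive_heat4 z rn)))) s3 y.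
by rewrite (_ : 4 * w = w + w + w + w) //; ring.
Qed.

End heat.

Section one_step.
Variables (R : realType) (w : R).
Hypothesis w0 : 0 <= w.
Implicit Types (x y z r s t b v : R).

Let U4 r := fdiff4 w (heat4 r).
Let U3 r := fdiff4 w (heat3 r).
Let U2 r := fdiff4 w (heat2 r).
Let U1 r := fdiff4 w (heat1 r).

Lemma fdiff4_heat1_lip r y z : 0 < r -> 0 <= z ->
  `|U1 r (y + z) - U1 r (y - z)| <= 6 * z.
Proof.
move=> r0 z0; have rn : r != 0 by rewrite gt_eqF.
have /andP[h1 h2] : (2 * z) * (- 3) <= U1 r (y - z + 2 * z) - U1 r (y - z) <= (2 * z) * 3.
  apply: increment_bounds (is_derive_fdiff4 w (fun y => is_derive_heat1 y rn)) _.
    by rewrite mulr_ge0.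
  by move=> x _ _; have := fdiff4_heat0_le x r0 w0; rewrite ler_norml.
rewrite (_ : y + z = y - z + 2 * z); last by ring.
by rewrite ler_norml; apply/andP; split; lra.
Qed.

(** [U2] is the derivative of [U3], so this is the error of the trapezoid rule on [[y - s, y + s]].
    The second derivative of [U2] is at most 3 in absolute value, and the classical constant gives
    [3 (2 s)^3 / 12 = 2 s^3]. *)
Lemma fdiff4_trapezoid r y s : 0 < r -> 0 <= s ->
  `|U3 r (y + s) - U3 r (y - s) - s * (U2 r (y + s) + U2 r (y - s))| <= 2 * s ^+ 3.
Proof.
move=> r0 s0; have rn : r != 0 by rewrite gt_eqF.
have d3 x := is_derive_fdiff4 w (fun y => is_derive_heat3 y rn) x.
have d2 x := is_derive_fdiff4 w (fun y => is_derive_heat2 y rn) x.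
have yp z := is_derive_add (is_derive_const y z) (is_derive_idfun z).
have ym z := is_derive_sub (is_derive_const y z) (is_derive_idfun z).
pose p z := U3 r (y + z) - U3 r (y - z) - z * (U2 r (y + z) + U2 r (y - z)).
pose dp z := - z * (U1 r (y + z) - U1 r (y - z)).
have hp z : is_derive z 1 p (dp z).
  apply: is_derive_eq (is_derive_sub (is_derive_sub
    (is_derive_comp (yp z) (d3 (y + z))) (is_derive_comp (ym z) (d3 (y - z))))
    (is_derive_mul (is_derive_idfun z) (is_derive_add
    (is_derive_comp (yp z) (d2 (y + z))) (is_derive_comp (ym z) (d2 (y - z)))))) _.
  by rewrite /dp /U1; ring.
have hq z : is_derive z 1 (fun z => 2 * z ^+ 3) (6 * z ^+ 2).
  apply: is_derive_eq (is_derive_mul (is_derive_const 2 z) (is_derive_pow 3 (is_derive_idfun z))) _.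
  by rewrite /=; ring.
have := derive_norm_le s0 (fun z _ _ => hp z) (fun z _ _ => hq z).
have p0 : p 0 = 0 by rewrite /p addr0 subr0; ring.
rewrite p0 subr0 expr0n mulr0 subr0; apply => z z0 _.
rewrite /dp normrM normrN (gtr0_norm z0) (_ : 6 * z ^+ 2 = z * (6 * z)); last by ring.
by rewrite ler_wpM2l ?fdiff4_heat1_lip ?ltW.
Qed.

Lemma fdiff4_linear a c (f g : R -> R) y :
  fdiff4 w (fun z => a * f z + c * g z) y = a * fdiff4 w f y + c * fdiff4 w g y.
Proof. by rewrite !fdiff4E; ring. Qed.

(* The heat equation cancels the second-order term of the symmetric step, and
   the trapezoid rule bounds the remaining fourth-order term. *)
Lemma fdiff4_heat4_step v b y : b ^+ 2 < v ->
  `|(U4 (Num.sqrt (v - b ^+ 2)) (y + b) + U4 (Num.sqrt (v - b ^+ 2)) (y - b)) / 2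
    - U4 (Num.sqrt v) y| <= b ^+ 4 / 4.
Proof.
wlog b0 : b / 0 <= b.
  move=> H bv; have [|b0] := leP 0 b; first by move=> /H; apply.
  have := H (- b); rewrite oppr_ge0 sqrrN opprK => /(_ (ltW b0) bv).
  by rewrite (addrC (U4 _ (y - b))) (_ : (- b) ^+ 4 = b ^+ 4)//; ring.
move=> bv.
(* The path shares a total variance [v] between a symmetric step of size [s] and a Gaussian of
   radius [rho s]: [s = 0] is purely Gaussian and [s = b] is the full sign step. Strictness of
   [b ^+ 2 < v] keeps the radius positive throughout. *)
pose rho s := Num.sqrt (v - s ^+ 2).
have pos s : 0 <= s -> s <= b -> 0 < v - s ^+ 2.
  by move=> s0 sb; rewrite subr_gt0 (le_lt_trans _ bv)// lerXn2r ?nnegrE.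
have rho0 s : 0 <= s -> s <= b -> 0 < rho s by move=> s0 sb; rewrite sqrtr_gt0 pos.
have drho s : 0 <= s -> s <= b -> is_derive s 1 rho (- s / rho s).
  move=> s0 sb; apply: is_derive_eq (is_derive_comp (is_derive_sub (is_derive_const v s)
    (is_derive_pow 2 (is_derive_idfun s))) (is_derive_sqrt (pos s s0 sb))) _.
  by rewrite /= expr1 -/(rho s); field; rewrite gt_eqF// rho0.
pose g s := (U4 (rho s) (y + s) + U4 (rho s) (y - s)) / 2.
pose dg s := (U3 (rho s) (y + s) - U3 (rho s) (y - s)
   - s * (U2 (rho s) (y + s) + U2 (rho s) (y - s))) / 2.
have hg s : 0 <= s -> s <= b -> is_derive s 1 g (dg s).
  move=> s0 sb; have rn : rho s != 0 by rewrite gt_eqF// rho0.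
  have dr := drho s s0 sb.
  have path (f : R -> R) e : is_derive s 1 f e ->
      is_derive s 1 (fun t => U4 (rho t) (f t)) (e * U3 (rho s) (f s) + (- s) * U2 (rho s) (f s)).
    move=> df; rewrite -fdiff4_linear.
    apply: (@is_derive_fdiff4_path _ w (fun t => heat4 (rho t))
      (fun t z => e * heat3 (rho t) z + (- s) * heat2 (rho t) z) f s) => c.
    apply: is_derive_eq (is_derive_heat4_path (y := fun t => f t + c) rn dr
      (is_derive_add df (is_derive_const c s))) _.
    by rewrite addr0; field.
  apply: is_derive_eq (is_derive_mul (is_derive_add
    (path _ _ (is_derive_add (is_derive_const y s) (is_derive_idfun s)))
    (path _ _ (is_derive_sub (is_derive_const y s) (is_derive_idfun s))))
    (is_derive_const 2^-1 s)) _.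
  by rewrite /dg; field.
have hq z : is_derive z 1 (fun z => z ^+ 4 / 4) (z ^+ 3).
  apply: is_derive_eq (is_derive_mul (is_derive_pow 4 (is_derive_idfun z)) (is_derive_const 4^-1 z)) _.
  by rewrite /=; field.
have := derive_norm_le b0 hg (fun z _ _ => hq z).
have -> : g 0 = U4 (Num.sqrt v) y.
  by rewrite /g /rho expr0n !subr0 addr0; field.
rewrite expr0n mul0r subr0; apply => s s0 sb.
rewrite /dg normrM [X in _ * X]ger0_norm ?invr_ge0// ler_pdivrMr//.
by rewrite [X in _ <= X]mulrC fdiff4_trapezoid ?rho0 ?ltW.
Qed.

End one_step.

(** * Rademacher sums *)

Section signs.
Variables (R : realType) (n : nat).
Implicit Types (s : {ffun 'I_n -> bool}) (F G : {ffun 'I_n -> bool} -> R).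

Definition sign_mean F : R := (\sum_s F s) / #|{ffun 'I_n -> bool}|%:R.

Lemma card_signs_gt0 : 0 < #|{ffun 'I_n -> bool}|%:R :> R.
Proof. by rewrite card_ffun card_bool ltr0n expn_gt0. Qed.

Lemma ler_sign_mean F G : (forall s, F s <= G s) -> sign_mean F <= sign_mean G.
Proof.
move=> FG; rewrite ler_pM2r ?invr_gt0 ?card_signs_gt0//.
by apply: ler_sum => s _.
Qed.

Lemma sign_mean_cst c : sign_mean (fun=> c) = c.
Proof.
rewrite /sign_mean sumr_const -(mulr_natr c) mulfK// gt_eqF//.
exact: card_signs_gt0.
Qed.

Lemma sign_meanD F G : sign_mean (fun s => F s + G s) = sign_mean F + sign_mean G.
Proof. by rewrite /sign_mean big_split/= mulrDl. Qed.

Lemma sign_meanN F : sign_mean (fun s => - F s) = - sign_mean F.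
Proof. by rewrite /sign_mean sumrN mulNr. Qed.

Lemma sign_meanZ c F : sign_mean (fun s => c * F s) = c * sign_mean F.
Proof. by rewrite /sign_mean -mulr_sumr mulrA. Qed.

Lemma sign_mean_sum I (r : seq I) (F : I -> {ffun 'I_n -> bool} -> R) :
  sign_mean (fun s => \sum_(i <- r) F i s) = \sum_(i <- r) sign_mean (F i).
Proof. by rewrite /sign_mean exchange_big mulr_suml. Qed.

Definition flip (k : 'I_n) s : {ffun 'I_n -> bool} := [ffun i => s i (+) (i == k)].

Lemma flipK k : involutive (flip k).
Proof. by move=> s; apply/ffunP => i; rewrite !ffunE addbK. Qed.

(** This plays the part of conditioning on all signs except the [k]-th: flipping that sign preserves
    the uniform law, so [F] may be averaged over the pair. *)
Lemma sign_mean_flip k F :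
  sign_mean F = sign_mean (fun s => (F s + F (flip k s)) / 2).
Proof.
have H : sign_mean (fun s => F (flip k s)) = sign_mean F.
  by rewrite /sign_mean [in RHS](reindex_inj (inv_inj (flipK k))).
transitivity (sign_mean (fun s => 2^-1 * (F s + F (flip k s)))).
  by rewrite sign_meanZ sign_meanD H; field.
by congr sign_mean; apply/funext => s; rewrite mulrC.
Qed.

Section walk.
Variable b : 'I_n -> R.

Definition walk (k : nat) s : R := \sum_(i < n | (i < k)%N) (-1) ^+ s i * b i.

Lemma walk0 s : walk 0 s = 0.
Proof. by rewrite /walk big_pred0. Qed.

Lemma walkn s : walk n s = \sum_i (-1) ^+ s i * b i.
Proof. by apply: eq_bigl => i; rewrite ltn_ord. Qed.

Lemma walkS (k : 'I_n) s : walk k.+1 s = walk k s + (-1) ^+ s k * b k.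
Proof.
rewrite /walk (bigD1 k)//= addrC; congr (_ + _); apply: eq_bigl => i.
by rewrite ltnS [RHS]ltn_neqAle andbC.
Qed.

Lemma walk_flip (k : 'I_n) s : walk k (flip k s) = walk k s.
Proof.
apply: eq_bigr => i ik; rewrite ffunE (_ : i == k = false) ?addbF//.
by apply/negbTE; rewrite neq_ltn ik.
Qed.

(** A supermartingale estimate with defects [e]: each averaged step raises [G] by at most [e k]. It
    serves both the Gaussian replacement and the fourth moment. *)
Lemma sign_mean_walk (G : nat -> R -> R) (e : 'I_n -> R) :
  (forall (k : 'I_n) y,
    (G k.+1 (y + b k) + G k.+1 (y - b k)) / 2 <= G k y + e k) ->
  sign_mean (fun s => G n (walk n s)) <= G 0%N 0 + \sum_i e i.
Proof.
move=> step.
suff H k : (k <= n)%N -> sign_mean (fun s => G k (walk k s)) <=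
    G 0%N 0 + \sum_(i < n | (i < k)%N) e i.
  apply: le_trans (H n (leqnn n)) _; rewrite lerD2l.
  by rewrite (eq_bigl xpredT)// => i; rewrite ltn_ord.
elim: k => [_|k IH kn].
  under eq_fun do rewrite walk0.
  by rewrite sign_mean_cst big_pred0// addr0.
pose k' := Ordinal kn.
rewrite (sign_mean_flip k').
apply: (@le_trans _ _ (sign_mean (fun s => G k (walk k s) + e k'))).
  apply: ler_sign_mean => s.
  rewrite (walkS k' s) (walkS k' (flip k' s)) walk_flip ffunE eqxx addbT/=.
  apply: le_trans (step k' (walk k s)).
  by case: (s k'); rewrite /= ?expr1 ?expr0 ?mulN1r ?mul1r // addrC.
rewrite sign_meanD sign_mean_cst (bigD1 k')//=.
rewrite (_ : \sum_(i < n | (i < k.+1)%N && (i != k')) e i = \sum_(i < n | (i < k)%N) e i).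
  by have := IH (ltnW kn); lra.
by apply: eq_bigl => i; rewrite ltnS [RHS]ltn_neqAle andbC.
Qed.

Definition rest_var (k : nat) : R := \sum_(i < n | (k <= i)%N) b i ^+ 2.

Lemma rest_var0 : rest_var 0 = \sum_i b i ^+ 2.
Proof. exact: eq_bigl. Qed.

Lemma rest_varn : rest_var n = 0.
Proof. by apply: big_pred0 => i; rewrite leqNgt ltn_ord. Qed.

Lemma rest_varS (k : 'I_n) : rest_var k = b k ^+ 2 + rest_var k.+1.
Proof.
rewrite /rest_var (bigD1 k)//=; congr (_ + _); apply: eq_bigl => i.
by rewrite [RHS]ltn_neqAle andbC eq_sym.
Qed.

Lemma rest_var_ge0 k : 0 <= rest_var k.
Proof. by apply: sumr_ge0 => i _; exact: sqr_ge0. Qed.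

(* The heat polynomial [y^4 + 6 y^2 v + 3 v^2] makes the fourth moment telescope. *)
Lemma sign_mean_fourth_moment : \sum_i b i ^+ 2 = 1 ->
  sign_mean (fun s => (\sum_i (-1) ^+ s i * b i) ^+ 4) <= 3.
Proof.
move=> b1.
pose G k y : R := y ^+ 4 + 6 * y ^+ 2 * rest_var k + 3 * rest_var k ^+ 2.
have G0 : G 0%N 0 = 3 by rewrite /G rest_var0 b1; ring.
have : sign_mean (fun s => G n (walk n s)) <= G 0%N 0 + \sum_(i < n) 0.
  apply: (sign_mean_walk (e := fun=> 0)) => k y; rewrite /G (rest_varS k) addr0.
  move: (rest_var _) (b k) => v c.
  rewrite -subr_ge0 (_ : _ - _ = 2 * (c ^+ 2) ^+ 2); last by field.
  by rewrite mulr_ge0// sqr_ge0.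
rewrite G0 sumr_const mul0rn addr0.
by under eq_fun do rewrite /G rest_varn expr0n/= !mulr0 !addr0 walkn.
Qed.

Section cdf.
Variables (w d eps : R).
Hypotheses (w0 : 0 < w) (d0 : 0 < d) (e0 : 0 < eps).
Hypothesis b1 : \sum_i b i ^+ 2 = 1.

Let U r y := fdiff4 w (heat4 r) y / w ^+ 4.

Let w4 : 0 < w ^+ 4. Proof. by rewrite exprn_gt0. Qed.

Let U_bounds r y : 0 < r -> heat0 r y <= U r y <= heat0 r (y + 4 * w).
Proof.
move=> r0; have /andP[h1 h2] := fdiff4_heat4_bounds y r0 (ltW w0).
by rewrite /U ler_pdivlMr// ler_pdivrMr// mulrC h1 mulrC h2.
Qed.

(** The Gaussian present at stage [k] carries the variance of the signs not yet used. The summand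
    [eps] keeps it nondegenerate at the last stage, where [rest_var n = 0]. *)
Let r_ k := Num.sqrt (rest_var k + eps).

Let r_gt0 k : 0 < r_ k.
Proof. by rewrite sqrtr_gt0 ltr_wpDl ?rest_var_ge0. Qed.

Let scale_step (p q r e : R) : `|(p + q) / 2 - r| <= e / 4 ->
  `|(p / w ^+ 4 + q / w ^+ 4) / 2 - r / w ^+ 4| <= e / (4 * w ^+ 4).
Proof.
move=> h; rewrite (_ : _ - _ = ((p + q) / 2 - r) / w ^+ 4); last first.
  by field; rewrite gt_eqF.
rewrite (_ : e / (4 * w ^+ 4) = e / 4 / w ^+ 4); last by field; rewrite gt_eqF.
by rewrite normrM [X in _ * X]gtr0_norm ?invr_gt0// ler_pM2r ?invr_gt0.
Qed.

Let abs_step (p q r e : R) : `|(p + q) / 2 - r| <= e -> (p + q) / 2 <= r + e.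
Proof. by rewrite ler_norml => /andP[_]; lra. Qed.

Let opp_step (p q r e : R) : `|(p + q) / 2 - r| <= e -> (- p + - q) / 2 <= - r + e.
Proof. by rewrite ler_norml => /andP[+ _]; lra. Qed.

Let U_step (k : 'I_n) t y :
  `|(U (r_ k.+1) (t - (y + b k)) + U (r_ k.+1) (t - (y - b k))) / 2 -
    U (r_ k) (t - y)| <= b k ^+ 4 / (4 * w ^+ 4).
Proof.
have bv : b k ^+ 2 < rest_var k + eps.
  by rewrite rest_varS -addrA ltrDl ltr_wpDl ?rest_var_ge0.
have := fdiff4_heat4_step (ltW w0) (t - y) bv.
have -> : rest_var k + eps - b k ^+ 2 = rest_var k.+1 + eps by rewrite rest_varS; ring.
rewrite -/(r_ k.+1) -/(r_ k).
have -> : t - (y + b k) = t - y - b k by ring.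
have -> : t - (y - b k) = t - y + b k by ring.
by rewrite [X in X / 2]addrC => h; exact: scale_step h.
Qed.

Let sum_e : \sum_i b i ^+ 4 / (4 * w ^+ 4) = (\sum_i b i ^+ 4) / (4 * w ^+ 4).
Proof. by rewrite mulr_suml. Qed.

Let U_upper t : sign_mean (fun s => U (Num.sqrt eps) (t - \sum_i (-1) ^+ s i * b i))
  <= U (Num.sqrt (1 + eps)) t + (\sum_i b i ^+ 4) / (4 * w ^+ 4).
Proof.
have := @sign_mean_walk (fun k y => U (r_ k) (t - y)) (fun i => b i ^+ 4 / (4 * w ^+ 4)) _.
rewrite sum_e /r_ rest_varn rest_var0 b1 add0r subr0.
under eq_fun do rewrite walkn.
by apply => k y; exact/abs_step/U_step.
Qed.

Let U_lower t : U (Num.sqrt (1 + eps)) t - (\sum_i b i ^+ 4) / (4 * w ^+ 4) <=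
  sign_mean (fun s => U (Num.sqrt eps) (t - \sum_i (-1) ^+ s i * b i)).
Proof.
have := @sign_mean_walk (fun k y => - U (r_ k) (t - y)) (fun i => b i ^+ 4 / (4 * w ^+ 4)) _.
rewrite sum_e /r_ rest_varn rest_var0 b1 add0r subr0.
under eq_fun do rewrite walkn.
rewrite sign_meanN => H; rewrite lerBlDr -lerN2 opprD -lerBrDr opprK.
by apply: H => k y; exact/opp_step/U_step.
Qed.

Let se : 0 < Num.sqrt eps. Proof. by rewrite sqrtr_gt0. Qed.

Let tail : 1 - eps / d ^+ 2 <= heat0 (Num.sqrt eps) d.
Proof.
have := Phi_ge (divr_gt0 d0 se).
rewrite (_ : (d / Num.sqrt eps) ^- 2 = eps / d ^+ 2)//.
rewrite -[X in _ = X / _](sqr_sqrtr (ltW e0)); field.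
by rewrite !gt_eqF.
Qed.

Let heat0_ge0 (r y : R) : 0 <= heat0 r y. Proof. exact: Phi_ge0. Qed.
Let heat0_le1 (r y : R) : heat0 r y <= 1. Proof. exact: Phi_le1. Qed.

Let S s : R := \sum_i (-1) ^+ s i * b i.

(** When [S s <= t], the smoothed indicator is evaluated at a point at least [d], where by [tail] it
    is at least [1 - eps / d ^+ 2]. Thus [d] is a margin for the residual Gaussian of variance
    [eps], and [4 * w] is the width of the spline. *)
Lemma rademacher_cdf_le t : sign_mean (fun s => (S s <= t)%R%:R) <=
  Phi ((t + d + 4 * w) / Num.sqrt (1 + eps))
  + (\sum_i b i ^+ 4) / (4 * w ^+ 4) + eps / d ^+ 2.
Proof.
apply: (@le_trans _ _ (sign_mean (fun s => U (Num.sqrt eps) (t + d - S s) + eps / d ^+ 2))).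
  apply: ler_sign_mean => s; have /andP[u1 _] := U_bounds (t + d - S s) se.
  have ed : 0 <= eps / d ^+ 2 by rewrite divr_ge0 ?sqr_ge0 ?ltW.
  have [St|_] /= := leP (S s) t; last by rewrite addr_ge0// (le_trans _ u1).
  rewrite -lerBlDr (le_trans tail)// (le_trans _ u1)// heat0_homo//; lra.
rewrite sign_meanD sign_mean_cst lerD2r (le_trans (U_upper _))// lerD2r.
have := U_bounds (t + d) (_ : 0 < Num.sqrt (1 + eps)).
rewrite sqrtr_gt0 => /(_ _)/andP[]//.
by rewrite addr_gt0.
Qed.

(** Here the upper half of [U_bounds] is used, so the argument is moved back by the spline width as
    well: if [S s > t], then even after adding [4 * w] it lies below [- d]. *)
Lemma rademacher_cdf_ge t :
  Phi ((t - d - 4 * w) / Num.sqrt (1 + eps))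
  - (\sum_i b i ^+ 4) / (4 * w ^+ 4) - eps / d ^+ 2
  <= sign_mean (fun s => (S s <= t)%R%:R).
Proof.
apply: (@le_trans _ _ (sign_mean (fun s => U (Num.sqrt eps) (t - d - 4 * w - S s) - eps / d ^+ 2))).
  rewrite sign_meanD sign_mean_cst lerD2r (le_trans _ (U_lower _))// lerD2r.
  have := U_bounds (t - d - 4 * w) (_ : 0 < Num.sqrt (1 + eps)).
  rewrite sqrtr_gt0 => /(_ _)/andP[]//.
  by rewrite addr_gt0.
apply: ler_sign_mean => s; have /andP[_ u1] := U_bounds (t - d - 4 * w - S s) se.
have ed : 0 <= eps / d ^+ 2 by rewrite divr_ge0 ?sqr_ge0 ?ltW.
rewrite lerBlDr (le_trans u1)//.
have [St|St] /= := leP (S s) t.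
  by have := heat0_le1 (Num.sqrt eps) (t - d - 4 * w - S s + 4 * w); lra.
have : heat0 (Num.sqrt eps) (t - d - 4 * w - S s + 4 * w) <= heat0 (Num.sqrt eps) (- d).
  by apply: heat0_homo => //; lra.
have -> : heat0 (Num.sqrt eps) (- d) = 1 - heat0 (Num.sqrt eps) d.
  by rewrite /heat0 mulNr PhiN.
by move: tail; lra.
Qed.

End cdf.
End walk.
End signs.

(** * Coordinates of the Walsh-Hadamard transform *)

Section hadamard.
Variable R : realType.

Lemma had_sqr m i j : had R m i j ^+ 2 = 1.
Proof.
elim: m i j => [|m IH] i j /=; first by rewrite expr1n.
by case: ifP => _; case: ifP => _; rewrite ?sqrrN IH.
Qed.

Lemma sum_ord_double n (f : nat -> R) :
  \sum_(i < n + n) f i = \sum_(i < n) f i + \sum_(i < n) f (n + i)%N.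
Proof. by rewrite big_split_ord. Qed.

(** The recursion splits [z] into halves with transforms [A] and [B], and the parallelogram identity
    for [A + B] and [A - B] doubles the sum of squares. Taking [z] on [nat] makes the second half a
    plain shift of the index. *)
Lemma had_parseval m (z : nat -> R) :
  \sum_(j < 2 ^ m) (\sum_(i < 2 ^ m) had R m j i * z i) ^+ 2 =
  (2 ^ m)%:R * \sum_(i < 2 ^ m) z i ^+ 2.
Proof.
elim: m z => [|m IH] z.
  by rewrite expn0 !big_ord1 /= !mul1r.
rewrite expnS mul2n -addnn; set n := (2 ^ m)%N.
rewrite (sum_ord_double n (fun j => (\sum_(i < n + n) had R m.+1 j i * z i) ^+ 2)).
rewrite (sum_ord_double n (fun i => z i ^+ 2)).
pose A j := \sum_(i < n) had R m j i * z i.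
pose B j := \sum_(i < n) had R m j i * z (n + i)%N.
have e1 (j : 'I_n) : \sum_(i < n + n) had R m.+1 j i * z i = A j + B j.
  rewrite (sum_ord_double n (fun i => had R m.+1 j i * z i)).
  congr (_ + _); apply: eq_bigr => i _ /=; rewrite -/n ltn_ord ?ltn_ord//.
  by rewrite ltnNge leq_addr/= addKn.
have e2 (j : 'I_n) : \sum_(i < n + n) had R m.+1 (n + j)%N i * z i = A j - B j.
  rewrite (sum_ord_double n (fun i => had R m.+1 (n + j)%N i * z i)) -sumrN.
  congr (_ + _); apply: eq_bigr => i _ /=; rewrite -/n (ltnNge (n + j)) leq_addr/= addKn.
    by rewrite ltn_ord.
  by rewrite ltnNge leq_addr/= addKn mulNr.
under eq_bigr do rewrite e1.
under [X in _ + X]eq_bigr do rewrite e2.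
rewrite -big_split/= (eq_bigr (fun j : 'I_n => 2 * A j ^+ 2 + 2 * B j ^+ 2)); last first.
  by move=> j _; ring.
rewrite big_split/= -!mulr_sumr /A /B IH (IH (fun i => z (n + i)%N)) -/n natrD.
by ring.
Qed.

End hadamard.

Section cdf_T.
Variables (R : realType) (m : nat) (u : 'cV[R]_(2 ^ m)).
Hypothesis hu : on_sphere u.
Variable k : 'I_(2 ^ m).
Notation n := (2 ^ m)%N.
Notation N := ((2 ^ m)%:R : R).
Implicit Types s : {ffun 'I_n -> bool}.

Let inner s (j : 'I_n) : R := \sum_i (-1) ^+ s i * (had R m j i * u i ord0).

Let coef s (j : 'I_n) : R := had R m k j * inner s j / Num.sqrt N.

Let N_gt0 : 0 < N. Proof. by rewrite ltr0n expn_gt0. Qed.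
Let sN_gt0 : 0 < Num.sqrt N. Proof. by rewrite sqrtr_gt0. Qed.
Let sN2 : Num.sqrt N ^+ 2 = N. Proof. by rewrite sqr_sqrtr// ltW. Qed.

Lemma TvecE s1 s2 : Num.sqrt N * Tvec s1 s2 u k ord0 =
  \sum_j (-1) ^+ s1 j * coef s2 j.
Proof.
rewrite /Tvec -!mulmxA mxE.
rewrite mulrA [X in X * _](_ : _ = (Num.sqrt N)^-1); last first.
  by rewrite -{2}sN2; field; rewrite gt_eqF.
rewrite mxE mulr_sumr; apply: eq_bigr => j _.
rewrite /rad_diag mul_diag_mx !mxE /coef /inner.
rewrite [X in _ * (_ * (_ * X))](_ : _ = \sum_i (-1) ^+ s2 i * (had R m j i * u i ord0)).
  by field; rewrite gt_eqF.
by apply: eq_bigr => i _; rewrite mul_diag_mx !mxE; ring.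
Qed.

Let coef_sqr s : \sum_j coef s j ^+ 2 = 1.
Proof.
(* The signed vector is extended by 0 to all of [nat], the form in which [had_parseval] takes it. *)
pose z (i : nat) : R := if insub i is Some i' then (-1) ^+ s i' * u i' ord0 else 0.
have zE (i : 'I_n) : z i = (-1) ^+ s i * u i ord0 by rewrite /z valK.
have innerE j : inner s j = \sum_(i < n) had R m j i * z i.
  by apply: eq_bigr => i _; rewrite zE; ring.
rewrite (eq_bigr (fun j : 'I_n => N^-1 * (\sum_(i < n) had R m j i * z i) ^+ 2)); last first.
  move=> j _; rewrite /coef innerE expr_div_n exprMn had_sqr sN2 mul1r mulrC//.
rewrite -mulr_sumr had_parseval (eq_bigr (fun i : 'I_n => u i ord0 ^+ 2)); last first.
  by move=> i _; rewrite zE exprMn sqrr_sign mul1r.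
by rewrite hu mulr1 mulVf// gt_eqF.
Qed.

(** Each [inner s j] is itself a Rademacher sum of unit variance, with fourth moment at most 3; the
    [N] coordinates, each scaled by [N ^- 2], add up to [3 / N]. This is the flattening effect of
    the second sign layer. *)
Let coef_fourth : sign_mean (fun s => \sum_j coef s j ^+ 4) <= 3 / N.
Proof.
rewrite sign_mean_sum.
apply: (@le_trans _ _ (\sum_(j < n) 3 / N ^+ 2)); last first.
  rewrite sumr_const card_ord -(mulr_natr (3 / N ^+ 2)) le_eqVlt; apply/orP; left; apply/eqP.
  by field; rewrite gt_eqF.
apply: ler_sum => j _.
have -> : (fun s => coef s j ^+ 4) = (fun s => N ^- 2 * inner s j ^+ 4).
  apply/funext => s; rewrite /coef.
  rewrite (_ : _ ^+ 4 = (had R m k j ^+ 2) ^+ 2 * inner s j ^+ 4 / (Num.sqrt N ^+ 2) ^+ 2); last first.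
    by field; rewrite gt_eqF.
  by rewrite had_sqr sN2 expr1n mul1r mulrC.
rewrite sign_meanZ mulrC ler_pM2r ?invr_gt0 ?exprn_gt0//.
apply: (sign_mean_fourth_moment (b := fun i => had R m j i * u i ord0)).
by under eq_bigr do rewrite exprMn had_sqr mul1r; exact: hu.
Qed.

Let cdf_TE t : cdf_T u k t =
  sign_mean (fun s2 => sign_mean (fun s1 =>
    (\sum_j (-1) ^+ s1 j * coef s2 j <= Num.sqrt N * t)%R%:R)).
Proof.
rewrite /cdf_T /sign_mean natrM invfM mulrA; congr (_ / _).
rewrite -mulr_suml; congr (_ / _).
rewrite exchange_big pair_big/= -sum1_card natr_sum big_mkcond/=.
apply: eq_bigr => -[s1 s2] _ /=; rewrite -TvecE ler_pM2l//.
rewrite (_ : (_ \in _) = (Tvec s1 s2 u k ord0 <= t)); first by case: (_ <= _).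
by apply/idP/idP => [/set_mem//|h]; exact/mem_set.
Qed.

Variables (w d eps : R).
Hypotheses (w0 : 0 < w) (d0 : 0 < d) (e0 : 0 < eps).

(** The parameters [w], [d], [eps] are the same for every second sign vector, so the conditional
    bounds average term by term and only the fourth-power sum has to be estimated in mean. *)
Lemma cdf_T_le t : cdf_T u k t <=
  Phi ((Num.sqrt N * t + d + 4 * w) / Num.sqrt (1 + eps))
  + 3 / (4 * N * w ^+ 4) + eps / d ^+ 2.
Proof.
rewrite cdf_TE; apply: le_trans (ler_sign_mean
  (fun s => rademacher_cdf_le w0 d0 e0 (coef_sqr s) (Num.sqrt N * t))) _.
rewrite 2!sign_meanD !sign_mean_cst lerD2r lerD2l.
under eq_fun do rewrite mulrC.
rewrite sign_meanZ mulrC ler_pdivrMr ?mulr_gt0 ?exprn_gt0//.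
rewrite (le_trans coef_fourth)// le_eqVlt; apply/orP; left; apply/eqP.
by field; rewrite !gt_eqF.
Qed.

Lemma cdf_T_ge t :
  Phi ((Num.sqrt N * t - d - 4 * w) / Num.sqrt (1 + eps))
  - 3 / (4 * N * w ^+ 4) - eps / d ^+ 2 <= cdf_T u k t.
Proof.
rewrite cdf_TE; apply: le_trans _ (ler_sign_mean
  (fun s => rademacher_cdf_ge w0 d0 e0 (coef_sqr s) (Num.sqrt N * t))).
rewrite 2!sign_meanD !sign_mean_cst sign_meanN lerD2r lerD2l lerN2.
under eq_fun do rewrite mulrC.
rewrite sign_meanZ mulrC ler_pdivrMr ?mulr_gt0 ?exprn_gt0//.
rewrite (le_trans coef_fourth)// le_eqVlt; apply/orP; left; apply/eqP.
by field; rewrite !gt_eqF.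
Qed.

Lemma cdf_T_ge0 t : 0 <= cdf_T u k t.
Proof. by rewrite divr_ge0. Qed.

Lemma cdf_T_le1 t : cdf_T u k t <= 1.
Proof.
rewrite ler_pdivrMr ?ltr0n ?muln_gt0 ?card_ffun ?card_bool ?expn_gt0// mul1r.
rewrite ler_nat (leq_trans (max_card _))// card_prod !card_ffun card_bool//.
Qed.

Lemma cdf_T_homo t t' : t <= t' -> cdf_T u k t <= cdf_T u k t'.
Proof.
move=> tt'; rewrite ler_wpM2r ?invr_ge0// ler_nat subset_leq_card//.
by apply/fintype.subsetP => s /set_mem/= st; apply/mem_set/(le_trans st).
Qed.

End cdf_T.

(** * Iterated integrals of radial functions *)

Section radial.
Variable R : realType.
Notation mu := (@lebesgue_measure R).
Implicit Types (a s x : R) (g : R -> \bar R) (h : R -> R -> \bar R).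

(** The accumulator [a] holds the squared norm of the coordinates already fixed, so the iterated
    integral of a radial function can be computed without vectors. *)
Fixpoint radial (n : nat) g a : \bar R :=
  match n with
  | 0 => g a
  | n'.+1 => (\int[mu]_x radial n' g (a + x ^+ 2))%E
  end.

Definition consr n x (v : 'rV[R]_n) : 'rV[R]_n.+1 := row_mx (\row_(_ < 1) x) v.

Lemma consr0 n x (v : 'rV[R]_n) : consr x v ord0 ord0 = x.
Proof. by rewrite mxE; case: splitP => // j _; rewrite mxE. Qed.

Lemma consrS n x (v : 'rV[R]_n) i : consr x v ord0 (lift ord0 i) = v ord0 i.
Proof.
rewrite mxE; case: splitP => [j|j] /=; first by rewrite ord1.
by move=> /eqP; rewrite /bump /= !add1n eqSS => /eqP ij; congr (v _ _); exact: val_inj.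
Qed.

Lemma sqnorm_consr n x (v : 'rV[R]_n) : sqnorm (consr x v) = x ^+ 2 + sqnorm v.
Proof.
rewrite /sqnorm big_ord_recl consr0; congr (_ + _).
by apply: eq_bigr => i _; rewrite consrS.
Qed.

Lemma iintS n (f : 'rV[R]_n.+1 -> \bar R) :
  iint f = (\int[mu]_x iint (fun v => f (consr x v)))%E.
Proof. by []. Qed.

Lemma iint_sqnorm n g a :
  iint (fun v : 'rV[R]_n => g (a + sqnorm v)) = radial n g a.
Proof.
elim: n a => [|n IH] a /=; first by rewrite /sqnorm big_ord0 addr0.
apply: eq_integral => x _; rewrite -IH; congr iint; apply/funext => v.
by rewrite -/(consr x v) sqnorm_consr addrA.
Qed.

Lemma radial_ge0 n g a : (forall x, (0 <= g x)%E) -> (0 <= radial n g a)%E.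
Proof.
by move=> g0; elim: n a => //= n IH a; apply: integral_ge0 => x _; exact: IH.
Qed.

Section joint.
Variable h : R -> R -> \bar R.
Hypothesis h0 : forall s a, (0 <= h s a)%E.
Hypothesis mh : measurable_fun [set: R * R] (fun p => h p.1 p.2).

Lemma measurable_radial n :
  measurable_fun [set: R * R] (fun p => radial n (h p.1) p.2).
Proof.
elim: n => //= n IH.
pose f (q : (R * R) * R) := radial n (h q.1.1) (q.1.2 + q.2 ^+ 2).
have mf : measurable_fun setT f.
  apply: (measurableT_comp IH (g := fun q : (R * R) * R => (q.1.1, q.1.2 + q.2 ^+ 2))).
  apply/measurable_fun_pairP; split => /=.
    exact: measurableT_comp measurable_fst measurable_fst.
  apply: measurable_funD.
    exact: measurableT_comp measurable_snd measurable_fst.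
  exact: measurable_funX.
have := @measurable_fun_fubini_tonelli_F _ _ _ _ R mu f mf.
apply=> q; exact: radial_ge0.
Qed.

Lemma radial_swap n a :
  (\int[mu]_x \int[mu]_s radial n (h s) (a + x ^+ 2) =
   \int[mu]_s \int[mu]_x radial n (h s) (a + x ^+ 2))%E.
Proof.
pose f (q : R * R) := radial n (h q.2) (a + q.1 ^+ 2).
apply: (@fubini_tonelli _ _ _ _ R mu mu f); last first.
  by move=> q; exact: radial_ge0.
apply: (measurableT_comp (measurable_radial n) (g := fun q : R * R => (q.2, a + q.1 ^+ 2))).
apply/measurable_fun_pairP; split => /=; first exact: measurable_snd.
by apply: measurable_funD => //; exact: measurable_funX.
Qed.

(** Coordinate [k] is brought to the outermost integral by one Tonelli exchange for each coordinate
    that precedes it; the others enter only through their squared norm. *)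
Lemma iint_coord n (k : 'I_n.+1) a :
  iint (fun v : 'rV[R]_n.+1 =>
    h (v ord0 k) (a + \sum_(i < n.+1 | i != k) v ord0 i ^+ 2)) =
  (\int[mu]_s radial n (h s) a)%E.
Proof.
elim: n k a => [|n IH] k a.
  rewrite /=; apply: eq_integral => x _; rewrite -/(consr x 0).
  rewrite big_pred0 ?addr0; last by move=> i; rewrite !ord1.
  by rewrite (ord1 k) consr0.
have [->|[j ->]] : k = ord0 \/ exists j, k = lift ord0 j.
  by case: (unliftP ord0 k) => [j ->|->]; [right; exists j|left].
  rewrite iintS; apply: eq_integral => x _; rewrite -iint_sqnorm.
  congr (@iint R n.+1 _); apply/funext => v; rewrite consr0.
  congr (h _ (_ + _)); rewrite big_mkcond big_ord_recl /= add0r.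
  by apply: eq_bigr => i _; rewrite consrS.
transitivity (\int[mu]_x \int[mu]_s radial n (h s) (a + x ^+ 2))%E; last exact: radial_swap.
rewrite iintS; apply: eq_integral => x _; rewrite -(IH j).
congr (@iint R n.+1 _); apply/funext => v; rewrite consrS.
congr (h _ _); rewrite -addrA; congr (_ + _).
rewrite big_mkcond big_ord_recl /= consr0; congr (_ + _).
rewrite [RHS]big_mkcond; apply: eq_bigr => i _.
by rewrite consrS (inj_eq (@lift_inj _ _)).
Qed.

End joint.

Lemma measurable_radial_sqr n g a : (forall x, (0 <= g x)%E) ->
  measurable_fun setT g ->
  measurable_fun setT (fun x : R => radial n g (a + x ^+ 2)).
Proof.
move=> g0 mg.
have := @measurable_radial (fun _ => g) (fun _ => g0)
  (measurableT_comp mg measurable_snd) n.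
move=> /(measurable_fun_pair2 (0 : R)) mr.
apply: (measurableT_comp mr).
by apply: measurable_funD => //; exact: measurable_funX.
Qed.

(** The accumulator only grows, so values below [a] are never met. At [a = 0] this lets pointwise
    bounds be proved for nonnegative squared norms alone. *)
Lemma le_radial n g1 g2 a :
  (forall x, (0 <= g1 x)%E) -> (forall x, (0 <= g2 x)%E) ->
  measurable_fun setT g1 -> measurable_fun setT g2 ->
  (forall x, a <= x -> (g1 x <= g2 x)%E) -> (radial n g1 a <= radial n g2 a)%E.
Proof.
move=> g10 g20 m1 m2; elim: n a => [|n IH] a g12 /=; first exact: g12.
apply: ge0_le_integral => //.
- by move=> x _; exact: radial_ge0.
- exact: measurable_radial_sqr.
- exact: measurable_radial_sqr.
- by move=> x _; apply: IH => y ay; apply: g12; rewrite (le_trans _ ay)// lerDl sqr_ge0.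
Qed.

Lemma radialD n g1 g2 a :
  (forall x, (0 <= g1 x)%E) -> (forall x, (0 <= g2 x)%E) ->
  measurable_fun setT g1 -> measurable_fun setT g2 ->
  radial n (fun x => g1 x + g2 x)%E a = (radial n g1 a + radial n g2 a)%E.
Proof.
move=> g10 g20 m1 m2; elim: n a => [|n IH] a //=.
under eq_integral do rewrite IH.
rewrite ge0_integralD//.
- by move=> x _; exact: radial_ge0.
- exact: measurable_radial_sqr.
- by move=> x _; exact: radial_ge0.
- exact: measurable_radial_sqr.
Qed.

End radial.

(** * Balls *)

Section primitives.
Variable R : realType.
Notation mu := (@lebesgue_measure R).
Implicit Types (f F : R -> R) (a b x t : R).

(* The base point [-2] makes the primitive differentiable on all of [[-1, 1]]. *)
Definition prim f t : R := \int[mu]_(x in `[-2, t]) f x.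

Lemma is_derive_prim f t : continuous f -> -2 < t -> is_derive t 1 (prim f) (f t).
Proof.
move=> cf t2; have t1 : t < t + 1 by rewrite ltrDl.
have [|//||d1 d2] := @continuous_FTC1_closed R f (-2) t (t + 1) t1.
- apply: continuous_compact_integrable; first exact: segment_compact.
  exact: continuous_subspaceT.
- exact: cf.
by split; [exact: d1|rewrite -derive1E; exact: d2].
Qed.

Lemma integral_itv_FTC f F a b : a <= b -> continuous f ->
  (forall x, a <= x -> x <= b -> is_derive x 1 F (f x)) ->
  (\int[mu]_(x in `[a, b]) (f x)%:E)%E = (F b - F a)%:E.
Proof.
rewrite le_eqVlt => /predU1P[->|ab] cf dF.
  by rewrite set_itv1 integral_set1 subrr.
have cF x : a <= x -> x <= b -> {for x, continuous F}.
  move=> ax xb; apply: differentiable_continuous; apply/derivable1_diffP.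
  by have [] := dF x ax xb.
rewrite EFinB; apply: continuous_FTC2 => //.
- exact: continuous_subspaceT.
- split.
  + by move=> x /[!in_itv]/= /andP[ax xb]; have [] := dF x (ltW ax) (ltW xb).
  + by apply: cvg_at_right_filter; apply: cF => //; exact: ltW.
  + by apply: cvg_at_left_filter; apply: cF => //; exact: ltW.
- move=> x /[!in_itv]/= /andP[ax xb].
  by have [_] := dF x (ltW ax) (ltW xb); rewrite derive1E.
Qed.

Lemma integral_support (f : R -> \bar R) a b :
  (forall x, ~ (a <= x <= b) -> f x = 0%E) ->
  (\int[mu]_x f x = \int[mu]_(x in `[a, b]) f x)%E.
Proof.
move=> f0; rewrite [RHS]integral_mkcond; apply: eq_integral => x _.
rewrite patchE; case: ifPn => // /negP xab; rewrite f0// => xab'; apply: xab.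
by apply/mem_set; rewrite /= in_itv.
Qed.

(** Up to a constant, the volume of the slice of the unit ball of dimension [n + 1] at height [x].
    Since [Num.sqrt] is 0 on negative numbers, it is continuous on the whole line and, for [n >= 1],
    vanishes outside [-1, 1]. *)
Definition semicircle n x : R := Num.sqrt (1 - x ^+ 2) ^+ n.

Lemma continuous_semicircle n : continuous (semicircle n).
Proof.
move=> x; apply: (@continuous_comp _ _ _ (fun x => Num.sqrt (1 - x ^+ 2)) (fun y => y ^+ n)).
  apply: (@continuous_comp _ _ _ (fun x => 1 - x ^+ 2) Num.sqrt).
    apply: cvgB; first exact: cvg_cst.
    exact: exprn_continuous.
  exact: sqrt_continuous.
exact: exprn_continuous.
Qed.

Lemma semicircle_ge0 n x : 0 <= semicircle n x.
Proof. by rewrite exprn_ge0. Qed.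

Definition semicircle_prim n := prim (semicircle n).

Lemma is_derive_semicircle_prim n x : -2 < x ->
  is_derive x 1 (semicircle_prim n) (semicircle n x).
Proof. by apply: is_derive_prim; exact: continuous_semicircle. Qed.

Lemma semicircle_prim_homo n x y : -2 < x -> x <= y ->
  semicircle_prim n x <= semicircle_prim n y.
Proof.
move=> x2 xy; apply: (derive_ndecr xy (df := semicircle n)).
  by move=> z xz _; apply: is_derive_semicircle_prim; exact: lt_le_trans xz.
by move=> z _ _; exact: semicircle_ge0.
Qed.

Definition semicircle_mass n : R := semicircle_prim n 1 - semicircle_prim n (-1).

Lemma semicircle_mass_gt0 n : 0 < semicircle_mass n.
Proof.
have h0 : 0 < Num.sqrt (3 / 4 : R) ^+ n by rewrite exprn_gt0// sqrtr_gt0 divr_gt0.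
have := @derive_le R (fun x => Num.sqrt (3 / 4) ^+ n * x) (fun=> Num.sqrt (3 / 4) ^+ n)
  (semicircle_prim n) (semicircle n) (- 2^-1) 2^-1.
have h1 x : is_derive x 1 (fun x => Num.sqrt (3 / 4) ^+ n * x) (Num.sqrt (3 / 4 : R) ^+ n).
  apply: is_derive_eq (is_derive_mul (is_derive_const _ x) (is_derive_idfun x)) _.
  by ring.
have h2 : (-2^-1 : R) <= 2^-1 by lra.
have h3 (x : R) : - 2^-1 <= x -> x <= 2^-1 -> is_derive x 1 (semicircle_prim n) (semicircle n x).
  by move=> x1 x2; apply: is_derive_semicircle_prim; lra.
have h4 (x : R) : - 2^-1 < x -> x < 2^-1 -> Num.sqrt (3 / 4) ^+ n <= semicircle n x.
  move=> x1 x2; rewrite lerXn2r ?nnegrE ?sqrtr_ge0// ler_sqrt; first nra.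
  by nra.
move=> /(_ h2 (fun x _ _ => h1 x) h3 h4).
have : semicircle_prim n 2^-1 <= semicircle_prim n 1 by apply: semicircle_prim_homo; lra.
have : semicircle_prim n (-1) <= semicircle_prim n (- 2^-1) by apply: semicircle_prim_homo; lra.
rewrite /semicircle_mass; lra.
Qed.

Fixpoint ball_vol n : R :=
  match n with
  | 0 => 2
  | n'.+1 => ball_vol n' * semicircle_mass n'.+1
  end.

Lemma ball_vol_gt0 n : 0 < ball_vol n.
Proof. by elim: n => //= n IH; rewrite mulr_gt0// semicircle_mass_gt0. Qed.

Definition ind (p : bool) : \bar R := if p then 1%E else 0%E.

Lemma ind_ge0 (p : bool) : (0 <= ind p)%E.
Proof. by case: p. Qed.

Lemma radialS n (g : R -> \bar R) a :
  radial n.+1 g a = (\int[mu]_x radial n g (a + x ^+ 2))%E.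
Proof. by []. Qed.

(* [ball_vol n] is the volume of the unit ball of dimension [n.+1]; for
   [c < a] the formula relies on [Num.sqrt] vanishing on negative numbers. *)
Lemma radial_ball n c a :
  radial n.+1 (fun q => ind (q <= c)) a = (ball_vol n * Num.sqrt (c - a) ^+ n.+1)%:E.
Proof.
elim: n a => [|n IH] a.
  rewrite /= expr1; have [ca|ac] := ltP c a.
    rewrite ltr0_sqrtr ?subr_lt0// mulr0; apply: integral0_eq => x _.
    by rewrite /ind leNgt (lt_le_trans ca) ?lerDl ?sqr_ge0.
  set r := Num.sqrt (c - a).
  have r0 : 0 <= r by exact: sqrtr_ge0.
  have r2 : r ^+ 2 = c - a by rewrite sqr_sqrtr// subr_ge0.
  have iE x : (a + x ^+ 2 <= c) = (- r <= x <= r).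
    by rewrite -ler_norml -lerBrDl -r2 -[x ^+ 2]real_normK ?num_real// ler_pXn2r ?nnegrE.
  rewrite (@integral_support _ (- r) r); last first.
    by move=> x; rewrite iE /ind; case: ifP.
  under eq_integral.
    move=> x /set_mem; rewrite /= in_itv/= iE => ->; over.
  rewrite /= (@integral_itv_FTC (fun=> 1) id) //.
  - by congr _%:E; ring.
  - by lra.
  - by move=> x; exact: cvg_cst.
rewrite radialS; under eq_integral do rewrite IH.
have [ca|ac] := leP c a.
  rewrite [in RHS]ler0_sqrtr ?subr_le0// expr0n/= mulr0; apply: integral0_eq => x _.
  rewrite ler0_sqrtr ?expr0n/= ?mulr0//.
  by have := sqr_ge0 x; lra.
set r := Num.sqrt (c - a).
have r0 : 0 < r by rewrite sqrtr_gt0 subr_gt0.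
have rn : r != 0 by rewrite gt_eqF.
have r2 : r ^+ 2 = c - a by rewrite sqr_sqrtr// subr_ge0 ltW.
have sE x : Num.sqrt (c - (a + x ^+ 2)) = r * Num.sqrt (1 - (x / r) ^+ 2).
  rewrite (_ : r * _ = Num.sqrt (r ^+ 2 * (1 - (x / r) ^+ 2))); last first.
    by rewrite sqrtrM ?sqr_ge0// sqrtr_sqr gtr0_norm.
  congr Num.sqrt.
  by rewrite (_ : c - (a + x ^+ 2) = r ^+ 2 - x ^+ 2); [field|rewrite r2; ring].
rewrite (@integral_support _ (- r) r); last first.
  move=> x xr; rewrite ler0_sqrtr ?expr0n/= ?mulr0//.
  have : r ^+ 2 <= x ^+ 2; last by rewrite r2; lra.
  rewrite -[x ^+ 2]real_normK ?num_real// ler_pXn2r ?nnegrE ?(ltW r0)// leNgt.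
  by apply/negP => h; apply: xr; rewrite -ler_norml ltW.
(* This is the substitution [x = r y]: the slices contribute [r^(n+1)] and the change of variable
   one more factor [r]. *)
pose F x := ball_vol n * (r ^+ n.+2 * semicircle_prim n.+1 (x / r)).
transitivity (F r - F (- r))%:E; last first.
  by rewrite /F mulNr divff// /= /semicircle_mass; congr _%:E; ring.
apply: (@integral_itv_FTC (fun x => ball_vol n * Num.sqrt (c - (a + x ^+ 2)) ^+ n.+1) F).
- by lra.
- move=> x; apply: cvgM; first exact: cvg_cst.
  apply: (@continuous_comp _ _ _ (fun x => Num.sqrt (c - (a + x ^+ 2))) (fun y => y ^+ n.+1)).
    apply: (@continuous_comp _ _ _ (fun x => c - (a + x ^+ 2)) Num.sqrt).
      apply: cvgB; first exact: cvg_cst.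
      apply: cvgD; first exact: cvg_cst.
      exact: exprn_continuous.
    exact: sqrt_continuous.
  exact: exprn_continuous.
- move=> x x1 x2.
  have xr : -2 < x / r.
    by rewrite ltr_pdivlMr//; lra.
  apply: is_derive_eq (is_derive_mul (is_derive_const (ball_vol n) x)
    (is_derive_mul (is_derive_const (r ^+ n.+2) x) (is_derive_comp
      (is_derive_mul (is_derive_idfun x) (is_derive_const r^-1 x))
      (is_derive_semicircle_prim n.+1 xr)))) _.
  by rewrite sE exprMn /semicircle (exprS r n.+1) /=; field.
Qed.

End primitives.

(** * Spherical marginals *)

Section sphere_cdf.
Variables (R : realType) (n : nat) (t : R).
Hypothesis n_even : ~~ odd n.
Hypothesis t1 : -1 <= t <= 1.
Notation mu := (@lebesgue_measure R).
Implicit Types (s r q : R).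

(** In [cone], [slab] and [gap], [s] is the distinguished coordinate and [r] the squared norm of the
    other [n + 1] coordinates. *)
Let cone s r := ind R [&& 0 < s ^+ 2 + r, s ^+ 2 + r <= 1
  & s <= t * Num.sqrt (s ^+ 2 + r)].
Let slab s r := ind R ((r <= 1 - s ^+ 2) && (s <= t)).
(** For nonzero [t] the second condition says [t^2 (s^2 + r) <= s^2], a double cone. The region
    covers the difference of [cone] and [slab], including the origin, which [cone] leaves out; for
    [t = 0], division by zero being 0, only the origin remains when [r >= 0]. *)
Let gap s r := ind R ((- `|t| <= s <= `|t|) && (r <= s ^+ 2 * ((1 - t ^+ 2) / t ^+ 2))).

Lemma measurable_ind d (T : measurableType d) (p : T -> bool) :
  measurable_fun setT p -> measurable_fun setT (fun x => ind R (p x)).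
Proof. by move=> mp; apply: measurable_fun_ifT. Qed.

Let mfst : measurable_fun [set: R * R] (fun p : R * R => p.1) := measurable_fst.
Let msnd : measurable_fun [set: R * R] (fun p : R * R => p.2) := measurable_snd.

Let mq : measurable_fun [set: R * R] (fun p : R * R => p.1 ^+ 2 + p.2).
Proof. by apply: measurable_funD => //; exact: measurable_funX. Qed.

Let mcone : measurable_fun [set: R * R] (fun p => cone p.1 p.2).
Proof.
apply: measurable_ind; apply: measurable_and; last apply: measurable_and.
- by apply: measurable_fun_ltr.
- by apply: measurable_fun_ler.
- apply: measurable_fun_ler => //; apply: measurable_funM => //.
  apply: measurableT_comp mq; apply: continuous_measurable_fun.
  exact: sqrt_continuous.
Qed.

Let mslab : measurable_fun [set: R * R] (fun p => slab p.1 p.2).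
Proof.
apply: measurable_ind; apply: measurable_and; apply: measurable_fun_ler => //.
by apply: measurable_funB => //; exact: measurable_funX.
Qed.

Let mgap : measurable_fun [set: R * R] (fun p => gap p.1 p.2).
Proof.
apply: measurable_ind; apply: measurable_and; first apply: measurable_and.
- by apply: measurable_fun_ler.
- by apply: measurable_fun_ler.
- apply: measurable_fun_ler => //.
  by apply: measurable_funM => //; exact: measurable_funX.
Qed.

Let cone_ge0 s r : (0 <= cone s r)%E. Proof. exact: ind_ge0. Qed.
Let slab_ge0 s r : (0 <= slab s r)%E. Proof. exact: ind_ge0. Qed.
Let gap_ge0 s r : (0 <= gap s r)%E. Proof. exact: ind_ge0. Qed.

Lemma ind_le_add (p p1 p2 : bool) : (p -> p1 || p2) -> (ind R p <= ind R p1 + ind R p2)%E.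
Proof.
case: p => [|_]; last by rewrite adde_ge0 ?ind_ge0.
move=> /(_ isT)/orP[->|->] /=; first by rewrite leeDl ?ind_ge0.
by rewrite leeDr ?ind_ge0.
Qed.

Let gapE s r q : 0 <= r -> q = s ^+ 2 + r -> t != 0 -> t ^+ 2 * q <= s ^+ 2 ->
  r <= s ^+ 2 * ((1 - t ^+ 2) / t ^+ 2).
Proof.
move=> r0 -> tn0 h; have t2 : 0 < t ^+ 2 by rewrite exprn_even_gt0//= tn0.
rewrite mulrA ler_pdivlMr//; lra.
Qed.

(** Since the norm [w] is at most 1, having [t < s <= t * w] forces [t < 0]; then [s] lies between
    [t] and 0 and [s^2 >= t^2 w^2]. The case of [slab_le] is the mirror image with [t > 0]. *)
Let cone_le s r : 0 <= r -> (cone s r <= slab s r + gap s r)%E.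
Proof.
move=> r0; apply: ind_le_add => /and3P[q_gt0 q1 h].
set w := Num.sqrt (s ^+ 2 + r) in h.
have w0 : 0 < w by rewrite sqrtr_gt0.
have w2 : w ^+ 2 = s ^+ 2 + r by rewrite sqr_sqrtr// ltW.
have w1 : w <= 1 by rewrite -(@ler_pXn2r _ 2)// ?nnegrE ?(ltW w0)// expr1n w2.
have [st|ts] := leP s t; first by rewrite andbT -lerBrDl in q1 *; rewrite q1.
have tlt0 : t < 0 by rewrite ltNge; apply/negP => t0; nra.
rewrite /= andbF /= ltr0_norm// opprK (ltW ts) /=.
rewrite (_ : s <= - t)/=; last by nra.
apply: (gapE r0 w2); first by rewrite lt_eqF.
have tw : t * w <= 0 by rewrite mulr_le0_ge0 ?ltW.
have := mulr_ge0 (_ : 0 <= t * w - s) (_ : 0 <= - (t * w) - s).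
by rewrite !subr_ge0 => /(_ h); lra.
Qed.

Let slab_le s r : 0 <= r -> (slab s r <= cone s r + gap s r)%E.
Proof.
move=> r0; apply: ind_le_add => /andP[q1 st].
have [q0|q0] := eqVneq (s ^+ 2 + r) 0.
  have s0 : s = 0 by apply/eqP; rewrite -sqrf_eq0 eq_le sqr_ge0 andbT; lra.
  have -> : r = 0 by move: q0; rewrite s0 expr0n/=; lra.
  by rewrite s0 expr0n/= addr0 ltxx mul0r lexx oppr_le0 normr_ge0.
have q_gt0 : 0 < s ^+ 2 + r by rewrite lt_neqAle eq_sym q0/= addr_ge0 ?sqr_ge0.
rewrite q_gt0 /= (_ : s ^+ 2 + r <= 1) /=; last by lra.
set w := Num.sqrt (s ^+ 2 + r).
have w0 : 0 < w by rewrite sqrtr_gt0.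
have w2 : w ^+ 2 = s ^+ 2 + r by rewrite sqr_sqrtr// ltW.
have w1 : w <= 1 by rewrite -(@ler_pXn2r _ 2)// ?nnegrE ?(ltW w0)// expr1n w2; lra.
have [//|h] := leP s (t * w).
have tgt0 : 0 < t by rewrite ltNge; apply/negP => t0; nra.
rewrite /= gtr0_norm// st (_ : - t <= s)/=; last by nra.
apply: (gapE r0 w2); first by rewrite gt_eqF.
have tw : 0 <= t * w by rewrite mulr_ge0 ?ltW.
have := mulr_ge0 (_ : 0 <= s - t * w) (_ : 0 <= s + t * w).
by rewrite subr_ge0 => /(_ (ltW h)); lra.
Qed.

Let radial0 k a : radial k (fun _ : R => 0%E) a = 0%E.
Proof. by elim: k a => //= k IH a; apply: integral0_eq => x _; exact: IH. Qed.

Let W := @semicircle_prim R n.+1.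

Let slab_int : (\int[mu]_s radial n.+1 (slab s) 0)%E =
  (ball_vol R n * (W t - W (-1)))%:E.
Proof.
have /andP[t1a t1b] := t1.
have slabE s : radial n.+1 (slab s) 0 =
    if s <= t then (ball_vol R n * semicircle n.+1 s)%:E else 0%E.
  rewrite /slab; case: (s <= t).
    under eq_fun do rewrite andbT.
    by rewrite radial_ball subr0.
  under eq_fun do rewrite andbF.
  exact: radial0.
under eq_integral do rewrite slabE.
rewrite (@integral_support _ _ (-1) t); last first.
  move=> s st; case: ifPn => // st'; rewrite /semicircle ler0_sqrtr ?expr0n/= ?mulr0//.
  have : s < -1 by rewrite ltNge; apply/negP => s1; apply: st; rewrite s1.
  by nra.
transitivity (\int[mu]_(s in `[(-1)%R, t]) (ball_vol R n * semicircle n.+1 s)%:E)%E.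
  by apply: eq_integral => s /set_mem; rewrite /= in_itv/= => /andP[_ ->].
rewrite mulrBr.
apply: (@integral_itv_FTC R (fun s => ball_vol R n * semicircle n.+1 s) (fun s => ball_vol R n * W s)) => //.
  move=> x; apply: cvgM; first exact: cvg_cst.
  exact: continuous_semicircle.
move=> x x1 x2; have x2' : -2 < x by lra.
apply: is_derive_eq (is_derive_mul (is_derive_const (ball_vol R n) x)
  (is_derive_semicircle_prim n.+1 x2')) _.
by rewrite mulr0 addr0.
Qed.

(** The slice at height [s] is a ball of dimension [n + 1] and radius at most [|s| / |t| <= 1]. One
    power of this ratio is given away: the remaining exponent [n] is even, so the integrand is a
    polynomial without absolute value of [s], with integral [2 |t| / (n + 1)]. *)
Let gap_int : (\int[mu]_s radial n.+1 (gap s) 0 <= (ball_vol R n * (2 / n.+1%:R))%:E)%E.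
Proof.
have /andP[t1a t1b] := t1.
have tau0 : 0 <= `|t| by [].
have tau1 : `|t| <= 1 by rewrite ler_norml; lra.
have b0 := ltW (ball_vol_gt0 R n).
have s_even (s : R) : 0 <= s ^+ n by rewrite exprn_even_ge0.
pose f (s : R) := ball_vol R n * (s / `|t|) ^+ n.
have cf : continuous f.
  move=> x; apply: cvgM; first exact: cvg_cst.
  apply: (@continuous_comp _ _ _ (fun s : R => s / `|t|) (fun y => y ^+ n)).
    by apply: cvgM; [exact: cvg_id|exact: cvg_cst].
  exact: exprn_continuous.
have gapE' s : (radial n.+1 (gap s) 0 <= (if (- `|t| <= s <= `|t|)%R then (f s)%:E else 0))%E.
  rewrite /gap; case: ifPn => [st|_]; last first.
    by under eq_fun do rewrite andFb; rewrite radial0.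
  under eq_fun do rewrite andTb.
  rewrite radial_ball subr0 lee_fin ler_pM2l ?ball_vol_gt0//.
  have [t0|t0] := eqVneq t 0.
    have -> : s = 0 by move: st; rewrite t0 normr0; lra.
    by rewrite expr0n/= mul0r sqrtr0 expr0n mul0r; case: (n) => //= k; rewrite ?expr0n.
  have tp : 0 < `|t| by rewrite normr_gt0.
  have y1 : `|s| / `|t| <= 1 by rewrite ler_pdivrMr// mul1r ler_norml.
  have y0 : 0 <= `|s| / `|t| by rewrite divr_ge0.
  have -> : (s / `|t|) ^+ n = (`|s| / `|t|) ^+ n.
    by rewrite -[LHS]ger0_norm ?s_even// normrX normrM normfV normr_id.
  apply: (@le_trans _ _ ((`|s| / `|t|) ^+ n.+1)); last first.
    by rewrite exprS ler_piMl// exprn_ge0.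
  rewrite lerXn2r ?nnegrE ?sqrtr_ge0//.
  rewrite -(@ler_pXn2r _ 2)// ?nnegrE ?sqrtr_ge0// sqr_sqrtr; last first.
    rewrite mulr_ge0 ?sqr_ge0// divr_ge0 ?sqr_ge0// subr_ge0.
    by rewrite -real_normK ?num_real// expr_le1.
  rewrite expr_div_n !real_normK ?num_real// ler_wpM2l ?sqr_ge0//.
  rewrite ler_pdivrMr ?exprn_even_gt0// mulVf ?sqrf_eq0//.
  by have := sqr_ge0 t; lra.
have mf : measurable_fun setT (fun s : R => if (- `|t| <= s <= `|t|)%R then (f s)%:E else 0%E).
  apply: measurable_fun_ifT => //.
    apply: measurable_and; exact: measurable_fun_ler.
  by apply/measurable_EFinP; exact: continuous_measurable_fun.
have f0 (s : R) : 0 <= f s by rewrite mulr_ge0.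
apply: (@le_trans _ _ (\int[mu]_s if (- `|t| <= s <= `|t|)%R then (f s)%:E else 0)%E).
  apply: ge0_le_integral => //.
  - by move=> s _; exact: radial_ge0.
  - exact: (measurable_fun_pair1 (0 : R) (measurable_radial gap_ge0 mgap n.+1)).
rewrite (@integral_support _ _ (- `|t|) `|t|); last first.
  by move=> s st; case: ifPn => // st'; case: st.
under eq_integral.
  move=> s /set_mem; rewrite /= in_itv/= => ->; over.
pose F (s : R) := ball_vol R n * (s ^+ n.+1 / n.+1%:R / `|t| ^+ n).
apply: (@le_trans _ _ (F `|t| - F (- `|t|))%:E); last first.
  rewrite lee_fin /F -mulrBr ler_wpM2l//.
    have [t0|tn] := eqVneq `|t| 0.
      by rewrite t0 oppr0 expr0n/= !mul0r subrr divr_ge0.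
    rewrite exprNn -signr_odd /= n_even expr1 mulN1r.
    rewrite (_ : _ - _ = 2 * `|t| / n.+1%:R); last first.
      have pn : `|t| ^+ n != 0 by rewrite expf_neq0.
      have an : n.+1%:R != 0 :> R by rewrite pnatr_eq0.
      rewrite exprS; move: (`|t| ^+ n) (n.+1%:R : R) pn an => p a pn an.
      by field; rewrite pn an.
    by rewrite ler_wpM2r ?invr_ge0//; lra.
rewrite le_eqVlt; apply/orP; left; apply/eqP; apply: integral_itv_FTC => //.
  by lra.
move=> x _ _; apply: is_derive_eq (is_derive_mul (is_derive_const (ball_vol R n) x)
    (is_derive_mul (is_derive_mul (is_derive_pow n.+1 (is_derive_idfun x)) (is_derive_const (n.+1%:R)^-1 x))
      (is_derive_const (`|t| ^+ n)^-1 x))) _.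
  rewrite /f expr_div_n /=; have : n.+1%:R != 0 :> R by rewrite pnatr_eq0.
  move: (n.+1%:R : R) (`|t| ^+ n)^-1 (x ^+ n) (x ^+ n.+1) => a b c d an.
  by field.
Qed.

Let mradial (h : R -> R -> \bar R) : (forall s r, (0 <= h s r)%E) ->
  measurable_fun [set: R * R] (fun p => h p.1 p.2) ->
  measurable_fun setT (fun s => radial n.+1 (h s) 0).
Proof.
by move=> h0 mh; exact: (measurable_fun_pair1 (0 : R) (measurable_radial h0 mh n.+1)).
Qed.

Let int_le (h1 h2 : R -> R -> \bar R) :
  (forall s r, (0 <= h1 s r)%E) -> measurable_fun [set: R * R] (fun p => h1 p.1 p.2) ->
  (forall s r, (0 <= h2 s r)%E) -> measurable_fun [set: R * R] (fun p => h2 p.1 p.2) ->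
  (forall s r, 0 <= r -> (h1 s r <= h2 s r + gap s r)%E) ->
  (\int[mu]_s radial n.+1 (h1 s) 0 <=
   \int[mu]_s radial n.+1 (h2 s) 0 + (ball_vol R n * (2 / n.+1%:R))%:E)%E.
Proof.
move=> h10 m1 h20 m2 h12.
have ms (h : R -> R -> \bar R) s : measurable_fun [set: R * R] (fun p => h p.1 p.2) ->
    measurable_fun setT (h s) by move=> mh; exact: (measurable_fun_pair2 s mh).
apply: (@le_trans _ _ (\int[mu]_s (radial n.+1 (h2 s) 0 + radial n.+1 (gap s) 0))%E).
  apply: ge0_le_integral => //.
  - by move=> s _; exact: radial_ge0.
  - exact: mradial.
  - by apply: emeasurable_funD; exact: mradial.
  - move=> s _; rewrite -radialD//; [|exact: ms|exact: ms].
    apply: le_radial => //.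
    + by move=> x; rewrite adde_ge0.
    + exact: ms.
    + by apply: emeasurable_funD; exact: ms.
    + by move=> x x0; exact: h12.
rewrite ge0_integralD//.
- by rewrite leeD2l// gap_int.
- by move=> s _; exact: radial_ge0.
- exact: mradial.
- by move=> s _; exact: radial_ge0.
- exact: mradial.
Qed.

Let vol_cone (k : 'I_n.+2) :
  vol [set x : 'rV[R]_n.+2 | x != 0 /\ sqnorm x <= 1
    /\ [set y : 'rV[R]_n.+2 | y ord0 k <= t] ((Num.sqrt (sqnorm x))^-1 *: x)] =
  (\int[mu]_s radial n.+1 (cone s) 0)%E.
Proof.
rewrite -(iint_coord cone_ge0 mcone k); congr iint; apply/funext => v.
have qE : sqnorm v = v ord0 k ^+ 2 + \sum_(i < n.+2 | i != k) v ord0 i ^+ 2.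
  by rewrite /sqnorm (bigD1 k).
rewrite /cone add0r -qE.
have q_ge0 : 0 <= sqnorm v by apply: sumr_ge0 => i _; exact: sqr_ge0.
have v0 : (v != 0) = (0 < sqnorm v).
  rewrite lt_neqAle q_ge0 andbT (eq_sym 0 (sqnorm v)); congr (~~ _).
  apply/eqP/eqP => [->|q0].
    by apply: big1 => i _; rewrite mxE expr0n.
  apply/rowP => i; rewrite mxE; apply/eqP; rewrite -sqrf_eq0.
  move/eqP: q0; rewrite psumr_eq0; last by move=> j _; exact: sqr_ge0.
  by move=> /allP/(_ i (mem_index_enum i)).
rewrite indicE (_ : (v \in _) = [&& 0 < sqnorm v, sqnorm v <= 1
  & v ord0 k <= t * Num.sqrt (sqnorm v)]); first by rewrite /ind; case: ifP.
apply/idP/idP => [/set_mem/= []|/and3P[q0 q1 vt]].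
  rewrite v0 => q0 [q1]; rewrite mxE q0 q1/= mulrC ler_pdivrMr ?sqrtr_gt0//.
apply/mem_set => /=; rewrite v0 q0 q1 mxE; split=> //; split=> //.
by rewrite mulrC ler_pdivrMr ?sqrtr_gt0.
Qed.

Let vol_ball : vol (@unit_ball R n.+2) = (ball_vol R n * semicircle_mass R n.+1)%:E.
Proof.
transitivity (radial n.+2 (fun q : R => ind R (q <= 1)) 0).
  rewrite -iint_sqnorm; congr iint; apply/funext => v.
  rewrite indicE add0r (_ : (v \in _) = (sqnorm v <= 1)); first by rewrite /ind; case: ifP.
  by apply/idP/idP => [/set_mem//|h]; exact/mem_set.
by rewrite radial_ball subr0 sqrtr1 expr1n mulr1.
Qed.

Lemma cdf_X_near (k : 'I_n.+2) :
  `|cdf_X k t - (W t - W (-1)) / semicircle_mass R n.+1|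
    <= 2 / (n.+1%:R * semicircle_mass R n.+1).
Proof.
have bv := ball_vol_gt0 R n; have mv := semicircle_mass_gt0 R n.+1.
have le1 := int_le cone_ge0 mcone slab_ge0 mslab cone_le.
have le2 := int_le slab_ge0 mslab cone_ge0 mcone slab_le.
rewrite /cdf_X /sphere_unif vol_cone vol_ball /=.
rewrite slab_int in le1 le2.
have : (0 <= \int[mu]_s radial n.+1 (cone s) 0)%E.
  by apply: integral_ge0 => s _; exact: radial_ge0.
(* [fine] would send an infinite integral to 0, so finiteness matters: [le1] rules out positive
   infinity and nonnegativity rules out negative infinity. *)
move: le1 le2; case: (\int[mu]_s _)%E => [c| |] //=.
rewrite -!EFinD !lee_fin => h1 h2 _.
have e : 2 / (n.+1%:R * semicircle_mass R n.+1) =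
    (ball_vol R n * (2 / n.+1%:R)) / (ball_vol R n * semicircle_mass R n.+1).
  have an : n.+1%:R != 0 :> R by rewrite pnatr_eq0.
  move: (n.+1%:R : R) an => a an.
  by field; rewrite an !gt_eqF.
rewrite e (_ : c / _ - _ = (c - ball_vol R n * (W t - W (-1))) / (ball_vol R n * semicircle_mass R n.+1)); last first.
  by field; rewrite !gt_eqF.
rewrite normrM [X in _ * X]gtr0_norm ?invr_gt0 ?mulr_gt0// ler_pM2r ?invr_gt0 ?mulr_gt0//.
clear e; move: (ball_vol R n * (W t - W (-1))) (ball_vol R n * (2 / n.+1%:R)) h1 h2 => A B h1 h2.
by rewrite ler_norml; apply/andP; split; [rewrite lerBrDr|rewrite lerBlDl]; lra.
Qed.

Lemma cdf_X_le1 (k : 'I_n.+2) : cdf_X k t <= 1.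
Proof.
pose ball s r := ind R (s ^+ 2 + r <= 1).
have mball : measurable_fun [set: R * R] (fun p => ball p.1 p.2).
  by apply: measurable_ind; exact: measurable_fun_ler.
have ball_ge0 s r : (0 <= ball s r)%E by exact: ind_ge0.
have ms (h : R -> R -> \bar R) s : measurable_fun [set: R * R] (fun p => h p.1 p.2) ->
    measurable_fun setT (h s) by move=> mh; exact: (measurable_fun_pair2 s mh).
have volB : vol (@unit_ball R n.+2) = (\int[mu]_s radial n.+1 (ball s) 0)%E.
  rewrite -(iint_coord ball_ge0 mball k); congr iint; apply/funext => v.
  rewrite indicE /ball add0r (_ : (v \in _) = (v ord0 k ^+ 2 +
    \sum_(i < n.+2 | i != k) v ord0 i ^+ 2 <= 1)); first by rewrite /ind; case: ifP.
  have -> : v ord0 k ^+ 2 + \sum_(i < n.+2 | i != k) v ord0 i ^+ 2 = sqnorm v.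
    by rewrite /sqnorm [RHS](bigD1 k).
  by apply/idP/idP => [/set_mem//|h]; exact/mem_set.
have le1 : (\int[mu]_s radial n.+1 (cone s) 0 <= vol (@unit_ball R n.+2))%E.
  rewrite volB; apply: ge0_le_integral.
  - exact: measurableT.
  - by move=> s _; exact: radial_ge0.
  - exact: mradial.
  - exact: mradial.
  - move=> s _; apply: le_radial; [exact: cone_ge0|exact: ball_ge0|exact: ms|exact: ms|].
    by move=> r _; rewrite /cone /ball /ind; case: ifP => [/and3P[_ -> _]//|_]; case: ifP.
have bv := ball_vol_gt0 R n; have mv := semicircle_mass_gt0 R n.+1.
rewrite vol_ball in le1.
rewrite /cdf_X /sphere_unif vol_cone vol_ball ler_pdivrMr ?mulr_gt0// mul1r.
have : (0 <= \int[mu]_s radial n.+1 (cone s) 0)%E.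
  by apply: integral_ge0 => s _; exact: radial_ge0.
by move: le1; case: (\int[mu]_s _)%E => [c| |].
Qed.

End sphere_cdf.

(** * The spherical distribution function beyond [[-1, 1]] *)

Section sphere_cdf_outside.
Variables (R : realType) (n : nat) (k : 'I_n) (t : R).

Let direction_bound (x : 'rV[R]_n) : `|((Num.sqrt (sqnorm x))^-1 *: x) ord0 k| <= 1.
Proof.
have q_ge0 : 0 <= sqnorm x by apply: sumr_ge0 => i _; exact: sqr_ge0.
have xk : x ord0 k ^+ 2 <= sqnorm x.
  by rewrite /sqnorm (bigD1 k)//= lerDl sumr_ge0// => i _; exact: sqr_ge0.
rewrite mxE normrM ger0_norm ?invr_ge0 ?sqrtr_ge0//.
have [q0|q0] := eqVneq (sqnorm x) 0; first by rewrite q0 sqrtr0 invr0 mul0r.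
have sq : 0 < Num.sqrt (sqnorm x) by rewrite sqrtr_gt0 lt_neqAle eq_sym q0.
rewrite mulrC ler_pdivrMr// mul1r -(@ler_pXn2r _ 2)// ?nnegrE ?normr_ge0 ?(ltW sq)//.
by rewrite real_normK ?num_real// sqr_sqrtr.
Qed.

Lemma cdf_X_ge0 : 0 <= cdf_X k t.
Proof.
have iint_ge0 j (f : 'rV[R]_j -> \bar R) : (forall v, (0 <= f v)%E) -> (0 <= iint f)%E.
  elim: j f => [|j IH] f f0; first exact: f0.
  by apply: integral_ge0 => x _; apply: IH => v; exact: f0.
by rewrite divr_ge0 ?fine_ge0 ?iint_ge0// => v; rewrite lee_fin.
Qed.

Lemma cdf_X_gt1 : 1 <= t -> cdf_X k t = cdf_X k 1.
Proof.
move=> t1; rewrite /cdf_X /sphere_unif; congr (fine (vol _) / _).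
apply/seteqP; split => x /= [x0 [x1 _]]; split=> //; split=> //.
  by have := direction_bound x; rewrite ler_norml => /andP[].
by have := direction_bound x; rewrite ler_norml => /andP[_ /le_trans]; apply.
Qed.

Lemma cdf_X_ltN1 : t < -1 -> cdf_X k t = 0.
Proof.
move=> t1; rewrite /cdf_X /sphere_unif (_ : [set x | _] = set0); last first.
  rewrite -subset0 => x /= [_ [_ xt]].
  by have := direction_bound x; rewrite ler_norml => /andP[]; lra.
rewrite (_ : vol set0 = 0%E) ?mul0r// /vol.
have -> : (fun x : 'rV[R]_n => (\1_set0 x)%:E) = (fun=> 0%E : \bar R).
  by apply/funext => x; rewrite indic0.
elim: (n) => //= j IH; apply: integral0_eq => x _; exact: IH.
Qed.

End sphere_cdf_outside.

(** * Spherical and Gaussian marginals *)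

Section pi_bounds.
Variable R : realType.
Implicit Types x : R.

Let dpow (c : R) n x : is_derive x 1 (fun y => c * y ^+ n) (c * (n%:R * x ^+ n.-1)).
Proof.
apply: is_derive_eq (is_derive_mul (is_derive_const c x) (is_derive_pow n (is_derive_idfun x))) _.
by ring.
Qed.

Lemma sin_le x : 0 <= x -> sin x <= x.
Proof.
move=> x0; have := derive_le x0 (fun z _ _ => is_derive_sin z)
  (fun z _ _ => is_derive_idfun z) (fun z _ _ => cos_le1 z).
by rewrite sin0 !subr0.
Qed.

Lemma cos_ge x : 0 <= x -> 1 - 2^-1 * x ^+ 2 <= cos x.
Proof.
move=> x0; have H (z : R) : 0 < z -> z < x -> - (2^-1 * (2 * z ^+ 1)) <= - sin z.
  by move=> z0 _; rewrite lerN2 expr1; have := sin_le (ltW z0); lra.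
have := derive_le x0 (fun z _ _ => is_derive_opp (dpow 2^-1 2 z))
  (fun z _ _ => is_derive_cos z) H.
by rewrite cos0 expr0n/=; lra.
Qed.

Lemma sin_ge x : 0 <= x -> x - 6^-1 * x ^+ 3 <= sin x.
Proof.
move=> x0; have H (z : R) : 0 < z -> z < x -> 1 - 6^-1 * (3 * z ^+ 2) <= cos z.
  by move=> z0 _; have := cos_ge (ltW z0); lra.
have := derive_le x0 (fun z _ _ => is_derive_sub (is_derive_idfun z) (dpow 6^-1 3 z))
  (fun z _ _ => is_derive_sin z) H.
by rewrite sin0 expr0n/=; lra.
Qed.

Lemma cos_le x : 0 <= x -> cos x <= 1 - 2^-1 * x ^+ 2 + 24^-1 * x ^+ 4.
Proof.
move=> x0.
have H (z : R) : 0 < z -> z < x ->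
   - sin z <= - (2^-1 * (2 * z ^+ 1)) + 24^-1 * (4 * z ^+ 3).
  by move=> z0 _; have := sin_ge (ltW z0); rewrite expr1; lra.
have := derive_le x0 (fun z _ _ => is_derive_cos z)
  (fun z _ _ => is_derive_add (is_derive_opp (dpow 2^-1 2 z)) (dpow 24^-1 4 z)) H.
by rewrite cos0 !expr0n/=; lra.
Qed.

(** The quartic upper bound for [cos] is already negative at 16/10, so half of pi cannot exceed that
    point. *)
Lemma pi_le : (pi : R) <= 32 / 10.
Proof.
have h : (pi : R) / 2 <= 16 / 10; last by lra.
rewrite leNgt; apply/negP => h.
have : 0 < cos (16 / 10 : R) by apply: cos_gt0_pihalf; rewrite h andbT; have := pi_gt0 R; lra.
have := @cos_le (16 / 10) (divr_ge0 (ler0n _ _) (ler0n _ _)).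
lra.
Qed.

(** The quadratic lower bound for [cos] is still positive, equal to 0.02, at 14/10, while [cos]
    decreases to 0 at half of pi. *)
Lemma pi_ge : 28 / 10 <= (pi : R).
Proof.
have h : 14 / 10 <= (pi : R) / 2; last by lra.
rewrite leNgt; apply/negP => h.
have [] : (14 / 10 : R) \in `[0, pi] /\ (pi / 2 : R) \in `[0, pi].
  by rewrite !in_itv/=; have := pi_ge2 R; split; apply/andP; split; lra.
move=> i1 i2; have : cos (14 / 10 : R) < cos (pi / 2) by rewrite ltr_cos.
rewrite cos_pihalf.
have := @cos_ge (14 / 10) (divr_ge0 (ler0n _ _) (ler0n _ _)).
by lra.
Qed.

Lemma normal_peak_le : normal_peak (1 : R) <= 43 / 100.
Proof.
have p := pi_ge; rewrite /normal_peak expr1n mul1r.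
have s0 : 0 < Num.sqrt (pi *+ 2 : R) by rewrite sqrtr_gt0 pmulrn_rgt0//; lra.
have q0 : (0 : R) < 43 / 100 by lra.
rewrite -[leRHS]invrK lef_pV2 ?posrE ?invr_gt0//.
rewrite -(@ler_pXn2r _ 2)// ?nnegrE ?invr_ge0 ?(ltW s0) ?(ltW q0)//.
rewrite sqr_sqrtr; last by rewrite mulrn_wge0//; lra.
by rewrite -mulr_natr; lra.
Qed.

End pi_bounds.

Section sphere_gauss.
Variables (R : realType) (n : nat).
Hypothesis n20 : (20 <= n)%N.
Notation N := (n%:R : R).
Implicit Types x t : R.

Let W := @semicircle_prim R n.
Let c := Num.sqrt N.
(** The product [A * g] is the density of the centred normal law of variance [1 / N], so [A] brings
    the primitive [K] to the scale of [p]. *)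
Let A : R := c * normal_peak 1.
Let g x := expR (- (N * x ^+ 2 / 2)).

Let N20 : 20 <= N. Proof. by rewrite (ler_nat R 20). Qed.
Let c0 : 0 < c. Proof. by rewrite sqrtr_gt0; have := N20; lra. Qed.
Let c2 : c ^+ 2 = N. Proof. by rewrite sqr_sqrtr//; have := N20; lra. Qed.
Let A0 : 0 < A. Proof. by rewrite mulr_gt0// normal_peak_gt0// oner_neq0. Qed.

Let gE x : gauss_pdf (c * x) = normal_peak 1 * g x.
Proof. by rewrite /gauss_pdf exprMn c2. Qed.

Let g_pow x : g x = expR (- (x ^+ 2 / 2)) ^+ n.
Proof. by rewrite -expRM_natr /g; congr expR; ring. Qed.

Let p x := Phi (c * x) - 2^-1.

Let Phi0 : Phi (0 : R) = 2^-1.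
Proof. by have := PhiN (0 : R); rewrite oppr0; lra. Qed.

Let dp x : is_derive x 1 p (A * g x).
Proof.
apply: is_derive_eq (is_derive_sub (is_derive_comp (is_derive_mul (is_derive_const c x)
  (is_derive_idfun x)) (is_derive_Phi (c * x))) (is_derive_const 2^-1 x)) _.
by rewrite gE /A; ring.
Qed.

Let dg x : is_derive x 1 g (- (N * x) * g x).
Proof.
apply: is_derive_eq (is_derive_comp (is_derive_opp (is_derive_mul (is_derive_mul
  (is_derive_const N x) (is_derive_pow 2 (is_derive_idfun x))) (is_derive_const 2^-1 x)))
  (is_derive_expR _)) _.
by rewrite /= -/(g x) expr1; field.
Qed.

Let semicircle_le x : 0 <= x -> x <= 1 -> semicircle n x <= g x.
Proof.
move=> x0 x1; rewrite /semicircle g_pow lerXn2r ?nnegrE ?sqrtr_ge0 ?expR_ge0//.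
have e : expR (- (x ^+ 2 / 2)) = Num.sqrt (expR (- x ^+ 2)).
  rewrite (_ : - x ^+ 2 = - (x ^+ 2 / 2) * 2%:R); last by field.
  by rewrite expRM_natr sqrtr_sqr ger0_norm ?expR_ge0.
by rewrite e ler_wsqrtr//; have := expR_ge1Dx (- x ^+ 2); lra.
Qed.

Let bernoulli (y : R) k : 0 <= y -> y <= 1 -> 1 - k%:R * y <= (1 - y) ^+ k.
Proof.
move=> y0 y1; elim: k => [|k IH]; first by rewrite mul0r subr0 expr0.
rewrite exprS; apply: (@le_trans _ _ ((1 - y) * (1 - k%:R * y))).
  rewrite -natr1; have : 0 <= k%:R * y ^+ 2 by rewrite mulr_ge0// sqr_ge0.
  lra.
by rewrite ler_wpM2l// subr_ge0.
Qed.

(** With [y = x^2], the inequality [1 + y <= expR y] gives [1 - y^2 <= (1 - y) expR y], hence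
    [expR (- y / 2) (1 - y^2) <= sqrt (1 - y)] after weakening [1 - y^2] to its square. Raise to the
    power [n] and apply Bernoulli. *)
Let semicircle_ge x : 0 <= x -> x <= 1 -> g x * (1 - N * x ^+ 4) <= semicircle n x.
Proof.
move=> x0 x1; set y := x ^+ 2.
have y0 : 0 <= y by exact: sqr_ge0.
have y1 : y <= 1 by rewrite expr_le1.
have y20 : 0 <= y ^+ 2 by exact: sqr_ge0.
have y21 : y ^+ 2 <= 1 by rewrite expr_le1.
apply: (@le_trans _ _ (g x * (1 - y ^+ 2) ^+ n)).
  rewrite ler_wpM2l ?expR_ge0//; apply: le_trans (bernoulli n y20 y21).
  by rewrite (_ : x ^+ 4 = y ^+ 2)// -exprM.
rewrite g_pow /semicircle -exprMn lerXn2r ?nnegrE ?sqrtr_ge0 ?mulr_ge0 ?expR_ge0 ?subr_ge0//.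
rewrite -/y -(@ler_pXn2r _ 2)// ?nnegrE ?sqrtr_ge0 ?mulr_ge0 ?expR_ge0 ?subr_ge0//.
rewrite sqr_sqrtr ?subr_ge0// exprMn -expRM_natr.
rewrite (_ : - (y / 2) * 2 = - y); last by field.
rewrite expRN mulrC ler_pdivrMr ?expR_gt0//.
apply: (@le_trans _ _ ((1 - y) * (1 + y))); last first.
  by rewrite ler_wpM2l ?subr_ge0// expR_ge1Dx.
rewrite (_ : (1 - y) * (1 + y) = 1 - y ^+ 2); last by ring.
by rewrite expr2 ler_piMl ?subr_ge0//; lra.
Qed.

Let dW x : 0 <= x -> is_derive x 1 W (semicircle n x).
Proof. by move=> x0; apply: is_derive_semicircle_prim; lra. Qed.

Let K x := W x - W 0.

Let p0 : p 0 = 0. Proof. by rewrite /p mulr0 Phi0 subrr. Qed.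

Let K_le x : 0 <= x -> x <= 1 -> A * K x <= p x.
Proof.
move=> x0 x1.
have dAW (z : R) : 0 <= z -> z <= x -> is_derive z 1 (fun z => A * W z) (A * semicircle n z).
  move=> z0 _; apply: is_derive_eq (is_derive_mul (is_derive_const A z) (dW z0)) _.
  by ring.
have := derive_le x0 dAW (fun z _ _ => dp z).
rewrite p0 subr0 -mulrBr; apply => z z0 zx.
by rewrite ler_pM2l// semicircle_le ?ltW// (lt_le_trans zx).
Qed.

Let K_ge x : 0 <= x -> x <= 1 -> (1 - 3 / N) * p x <= A * K x.
Proof.
move=> x0 x1; have Nn : N != 0 by rewrite gt_eqF//; have := N20; lra.
have dAW (z : R) : 0 <= z -> z <= x -> is_derive z 1 (fun z => A * W z) (A * semicircle n z).
  move=> z0 _; apply: is_derive_eq (is_derive_mul (is_derive_const A z) (dW z0)) _.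
  by ring.
(* Two integrations by parts turn [N z^4 g] into [(3 / N) g] and a boundary term; that term has a
   favourable sign in [H] and is dropped at the end. *)
pose H z := (1 - 3 / N) * p z + A * ((z ^+ 3 + (3 / N) * z) * g z).
have dH (z : R) : is_derive z 1 H (A * (g z * (1 - N * z ^+ 4))).
  apply: is_derive_eq (is_derive_add (is_derive_mul (is_derive_const (1 - 3 / N) z) (dp z))
    (is_derive_mul (is_derive_const A z) (is_derive_mul (is_derive_add
      (is_derive_pow 3 (is_derive_idfun z)) (is_derive_mul (is_derive_const (3 / N) z)
      (is_derive_idfun z))) (dg z)))) _.
  by rewrite /=; field.
have := derive_le x0 (fun z _ _ => dH z) dAW.
have H0 : H 0 = 0 by rewrite /H p0 expr0n/=; ring.
rewrite H0 subr0 -mulrBr -/(K x) => h; apply: le_trans (h _).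
  rewrite lerDl mulr_ge0 ?(ltW A0)// mulr_ge0 ?expR_ge0//.
  by rewrite addr_ge0 ?exprn_ge0// mulr_ge0// divr_ge0.
move=> z z0 zx; rewrite ler_pM2l// semicircle_ge ?ltW//.
exact: lt_le_trans zx x1.
Qed.

Let W_odd x : 0 <= x -> x <= 1 -> W (- x) = W 0 - K x.
Proof.
move=> x0 x1.
have dN (z : R) : 0 <= z -> z <= x -> is_derive z 1 (fun z => W z + W (- z)) 0.
  move=> z0 zx; have zN : -2 < - z by lra.
  apply: is_derive_eq (is_derive_add (dW z0) (is_derive_comp (is_derive_opp
    (is_derive_idfun z)) (is_derive_semicircle_prim n zN))) _.
  by rewrite /semicircle sqrrN; ring.
have W2 : W x + W (- x) = W 0 + W 0.
  apply/eqP; rewrite -subr_eq0 -normr_le0.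
  have := @derive_norm_le R (fun z => W z + W (- z)) (fun=> 0) (fun=> 0) (fun=> 0)
    0 x x0 dN (fun z _ _ => is_derive_const 0 z).
  by rewrite oppr0 /= => h; apply: le_trans (h _) _ => [z _ _|]; rewrite ?normr0 ?subrr.
by rewrite /K; lra.
Qed.

Let p1_ge : 2^-1 - N^-1 <= p 1.
Proof. by have := Phi_ge c0; rewrite c2 /p mulr1; lra. Qed.

Let p1_le : p 1 <= 2^-1.
Proof. by have := Phi_le1 (c * 1); rewrite /p; lra. Qed.

Let iN0 : 0 < N^-1. Proof. by rewrite invr_gt0; have := N20; lra. Qed.
Let iN20 : N^-1 <= 20^-1. Proof. by rewrite lef_pV2 ?posrE//; have := N20; lra. Qed.

Let massE : semicircle_mass R n = 2 * K 1.
Proof. by rewrite /semicircle_mass -/W W_odd// /K; ring. Qed.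

Lemma semicircle_mass_ge :
  2 * (1 - 3 / N) * (1 - 2 / N) / c <= semicircle_mass R n.
Proof.
have k1 := K_ge ler01 (lexx 1); rewrite massE -mulrA -mulrA ler_pM2l//.
have pk : normal_peak (1 : R) <= 2^-1 by have := normal_peak_le R; lra.
have e0 : 0 <= 1 - 3 / N by have := iN20; lra.
have K0 : 0 <= K 1.
  by rewrite -(pmulr_rge0 _ A0) (le_trans _ k1)// mulr_ge0//; have := p1_ge; have := iN20; lra.
rewrite mulrA ler_pdivrMr//.
have : A * K 1 <= c * 2^-1 * K 1 by rewrite ler_wpM2r// ler_wpM2l// ltW.
have : (1 - 3 / N) * (2^-1 - N^-1) <= (1 - 3 / N) * p 1 by rewrite ler_wpM2l// p1_ge.
lra.
Qed.

Lemma semicircle_gauss t : -1 <= t <= 1 ->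
  `|(W t - W (-1)) / semicircle_mass R n - Phi (c * t)| <= 4 / N.
Proof.
have e0 : 0 < 1 - 3 / N by have := iN20; lra.
have p1 : 0 < p 1 by have := p1_ge; have := iN20; lra.
have k1 := K_ge ler01 (lexx 1).
have K1 : 0 < K 1 by rewrite -(pmulr_rgt0 _ A0) (lt_le_trans _ k1)// mulr_gt0.
have main x : 0 <= x -> x <= 1 -> `|K x / (2 * K 1) - p x| <= 4 / N.
  move=> x0 x1.
  have px0 : 0 <= p x by rewrite -p0 lerD2r Phi_homo// ler_pM2l.
  have px1 : p x <= p 1 by rewrite lerD2r Phi_homo// ler_pM2l.
  have kx := K_ge x0 x1; have kx' := K_le x0 x1; have k1' := K_le ler01 (lexx 1).
  (* Numerator and denominator are put on the normal scale together, so the exact mass of the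
     semicircle weight is never computed. *)
  have -> : K x / (2 * K 1) = (A * K x) / (2 * (A * K 1)).
    by field; rewrite !gt_eqF.
  have AK1 : 0 < A * K 1 by rewrite mulr_gt0.
  move: (A * K x) (A * K 1) (p x) (p 1) (N^-1) kx kx' k1 k1' px0 px1 p1 p1_ge p1_le iN0 iN20 e0 AK1
    => a b q r i kx kx' k1 k1' q0 qr r0 r1 r2 i0 i6 e0 b0.
  rewrite ler_norml; apply/andP; split.
    rewrite lerBrDr ler_pdivlMr ?mulr_gt0//.
    have : (- (4 * i) + q) * (2 * b) <= (1 - 3 * i) * q; last by lra.
    have [neg|pos] := leP (- (4 * i) + q) 0.
      by apply: (@le_trans _ _ 0); [rewrite mulr_le0_ge0//; lra|rewrite mulr_ge0// ltW].
    apply: (@le_trans _ _ (- (4 * i) + q)); first by rewrite ler_piMr ?(ltW pos)//; lra.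
    nra.
  rewrite lerBlDr ler_pdivrMr ?mulr_gt0//.
  (* Since [r >= 1/2 - i], the quotient has relative error about [5 i]. As [q <= 1/2], this is about
     [5 i / 2] in absolute terms, and [i <= 1/20] lets the higher-order terms fit into [4 i]. *)
  have : q <= (4 * i + q) * (2 * ((1 - 3 * i) * r)).
    have h1 : (1 - 3 * i) * (1 - 2 * i) <= 2 * ((1 - 3 * i) * r) by nra.
    apply: (@le_trans _ _ ((4 * i + q) * ((1 - 3 * i) * (1 - 2 * i)))).
      have : 0 <= i * (2^-1 - q) by rewrite mulr_ge0 ?(ltW i0)//; lra.
      have : 0 <= i * (20^-1 - i) by rewrite mulr_ge0 ?(ltW i0)//; lra.
      have : 0 <= q * i ^+ 2 by rewrite mulr_ge0 ?sqr_ge0.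
      have : 0 <= i * i ^+ 2 by rewrite mulr_ge0 ?sqr_ge0 ?(ltW i0).
      lra.
    by rewrite ler_wpM2l//; lra.
  have : (4 * i + q) * (2 * ((1 - 3 * i) * r)) <= (4 * i + q) * (2 * b).
    by rewrite ler_wpM2l; lra.
  lra.
move=> /andP[t1 t2]; rewrite massE.
have -> : W (-1) = W 0 - K 1 by rewrite W_odd.
have [t0|t0] := leP 0 t.
  have -> : (W t - (W 0 - K 1)) / (2 * K 1) - Phi (c * t) = K t / (2 * K 1) - p t.
    by rewrite /p /K; field; rewrite gt_eqF// -/(K 1).
  exact: main.
have Nt0 : 0 <= - t by lra.
have Nt1 : - t <= 1 by lra.
have := main _ Nt0 Nt1; rewrite -normrN.
have Wt := W_odd Nt0 Nt1; rewrite opprK in Wt.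
have -> : Phi (c * t) = 1 - Phi (c * - t) by rewrite -PhiN mulrN opprK.
rewrite Wt (_ : - (_ - _) = (W 0 - K (- t) - (W 0 - K 1)) / (2 * K 1) - (1 - Phi (c * - t)))//.
rewrite /p; move: (K (-t)) (K 1) K1 (Phi _) (W 0) => a b b0 q r.
by field; rewrite gt_eqF.
Qed.

End sphere_gauss.

(** * Numerical bounds *)

Section numerics.
Variable R : realType.

Lemma powR_exp (a r : R) k : (powR a r) ^+ k = powR a (r * k%:R).
Proof. by rewrite -powR_mulrn ?powR_ge0// -powRrM. Qed.

Lemma ler_inv (a b : R) : 0 < a -> a <= b -> b^-1 <= a^-1.
Proof. by move=> a0 ab; rewrite lef_pV2 ?posrE// (lt_le_trans a0). Qed.

(** The value 3.3 exceeds the factor 3 of the large-dimension bound and makes the claim trivial in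
    small dimension. The second summand is at least 1 because pi is at most 4; the first is at least
    [12 / 5.1]. *)
Lemma C_pos_ge : 33 / 10 <= C_pos R.
Proof.
have pi0 := pi_gt0 R; have pi3 := pi_le R.
have a : 24 / 10 <= powR 3 (4 / 5) :> R.
  rewrite -(@ler_pXn2r _ 5)// ?nnegrE ?powR_ge0 ?divr_ge0//.
  rewrite powR_exp (_ : 4 / 5 * 5%:R = 4%:R :> R); last by field.
  by rewrite powR_mulrn//; lra.
have b : powR pi (7 / 5) <= 51 / 10 :> R.
  rewrite -(@ler_pXn2r _ 5)// ?nnegrE ?powR_ge0 ?divr_ge0//.
  rewrite powR_exp (_ : 7 / 5 * 5%:R = 7%:R :> R); last by field.
  rewrite powR_mulrn ?(ltW pi0)//; apply: (@le_trans _ _ ((32 / 10) ^+ 7)).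
    by rewrite lerXn2r ?nnegrE ?(ltW pi0)//; lra.
  by lra.
have c : powR pi (1 / 4) <= Num.sqrt 2 :> R.
  rewrite -(@ler_pXn2r _ 4)// ?nnegrE ?powR_ge0 ?sqrtr_ge0//.
  rewrite powR_exp (_ : 1 / 4 * 4%:R = 1 :> R); last by field.
  rewrite powRr1 ?(ltW pi0)// (exprM _ 2 2) sqr_sqrtr//; lra.
have b0 : 0 < powR pi (7 / 5) :> R by rewrite powR_gt0.
have c0 : 0 < powR pi (1 / 4) :> R by rewrite powR_gt0.
have h1 : 12 / (51 / 10) <= 5 * powR 3 (4 / 5) / powR pi (7 / 5) :> R.
  rewrite ler_pdivlMr//; apply: (@le_trans _ _ (12 / (51 / 10) * (51 / 10))).
    by rewrite ler_wpM2l.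
  by lra.
have h2 : 1 <= Num.sqrt 2 / powR pi (1 / 4) :> R by rewrite ler_pdivlMr// (mul1r (powR _ _)).
rewrite /C_pos; lra.
Qed.

Lemma cdf_X_near_dim d (k : 'I_d) (t : R) : (2 <= d)%N -> ~~ odd d -> -1 <= t <= 1 ->
  `|cdf_X k t - (semicircle_prim d.-1 t - semicircle_prim d.-1 (-1)) / semicircle_mass R d.-1|
    <= 2 / (d.-1%:R * semicircle_mass R d.-1).
Proof.
case: d k => [|[|n]] k // _ dn t1; apply: cdf_X_near => //.
by move: dn; rewrite /= negbK.
Qed.

Lemma cdf_X_le1_dim d (k : 'I_d) (t : R) : (2 <= d)%N -> cdf_X k t <= 1.
Proof. by case: d k => [|[|n]] k // _; exact: cdf_X_le1. Qed.

Lemma ratio_gap (n : nat) : (511 <= n)%N ->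
  2 / (n%:R * semicircle_mass R n) <= 103 / 100 / Num.sqrt n%:R.
Proof.
move=> n511; have N511 : 511 <= n%:R :> R by rewrite (ler_nat R 511).
have n20 : (20 <= n)%N by apply: leq_trans n511.
have mg := @semicircle_mass_ge R n n20.
have m0 := semicircle_mass_gt0 R n.
have c0 : 0 < Num.sqrt n%:R :> R by rewrite sqrtr_gt0; lra.
have c2 : Num.sqrt n%:R ^+ 2 = n%:R :> R by rewrite sqr_sqrtr//; lra.
have i : (n%:R : R)^-1 <= 511^-1 by apply: ler_inv; lra.
have i0 : 0 < (n%:R : R)^-1 by rewrite invr_gt0; lra.
have N0 : 0 < n%:R :> R by lra.
rewrite ler_pdivrMr// in mg.
rewrite ler_pdivrMr ?mulr_gt0//.
have mg2 : 2 * (1 - 3 / n%:R) * (1 - 2 / n%:R) >= 196 / 100 :> R.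
  by move: (n%:R^-1) i i0 => j *; nra.
have := le_trans mg2 mg.
rewrite -{3}c2; move: (Num.sqrt n%:R) (semicircle_mass R n) c0 => c M c0 mc.
rewrite (_ : 103 / 100 / c * (c ^+ 2 * M) = 103 / 100 * (M * c)); first lra.
by field; rewrite gt_eqF.
Qed.

(** * Comparison of the two laws in dimension at least 512 *)

Section large_dimension.
Variables (m : nat) (u : 'cV[R]_(2 ^ m)) (k : 'I_(2 ^ m)) (x : R).
Hypotheses (hu : on_sphere u) (m9 : (9 <= m)%N) (x0 : 0 < x).
Notation d := (2 ^ m)%N.
Notation D := ((2 ^ m)%:R : R).
Hypothesis x5 : x ^+ 5 * D = 1.
Let n := d.-1.
Let N : R := n%:R.

Let d512 : (512 <= d)%N. Proof. by rewrite (leq_pexp2l (m := 2) (n1 := 9)). Qed.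
Let D512 : 512 <= D. Proof. by rewrite (ler_nat R 512). Qed.
Let ND : N = D - 1. Proof. by rewrite /N /n -subn1 natrB// (leq_trans _ d512). Qed.
Let n511 : (511 <= n)%N. Proof. by rewrite -ltnS /n prednK// (leq_trans _ d512). Qed.
Let DV : D^-1 = x ^+ 5.
Proof. by rewrite -[RHS](mulfK (x := D)) ?x5 ?mul1r// gt_eqF//; have := D512; lra. Qed.

Let x29 : x <= 29 / 100.
Proof.
rewrite leNgt; apply/negP => xx.
have : (29 / 100) ^+ 5 < x ^+ 5 by rewrite ltrXn2r//; lra.
have : x ^+ 5 <= 512^-1 by rewrite -DV; apply: ler_inv; have := D512; lra.
lra.
Qed.

Let y := (Num.sqrt D)^-1.
Let sD0 : 0 < Num.sqrt D. Proof. by rewrite sqrtr_gt0; have := D512; lra. Qed.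
Let sD2 : Num.sqrt D ^+ 2 = D. Proof. by rewrite sqr_sqrtr//; have := D512; lra. Qed.
Let sN0 : 0 < Num.sqrt N. Proof. by rewrite sqrtr_gt0 ND; have := D512; lra. Qed.
Let sN2 : Num.sqrt N ^+ 2 = N. Proof. by rewrite sqr_sqrtr// ND; have := D512; lra. Qed.
Let y0 : 0 < y. Proof. by rewrite invr_gt0. Qed.

Let y_le : y <= 16 / 100 * x.
Proof.
rewrite -(@ler_pXn2r _ 2)// ?nnegrE ?(ltW y0) ?mulr_ge0 ?(ltW x0)//.
rewrite /y exprVn sD2 DV.
have x3 : x ^+ 3 <= (29 / 100) ^+ 3 by rewrite lerXn2r ?nnegrE ?(ltW x0).
rewrite (_ : x ^+ 5 = x ^+ 2 * x ^+ 3); last by ring.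
rewrite exprMn [X in _ <= X]mulrC ler_wpM2l ?sqr_ge0//.
by apply: le_trans x3 _; lra.
Qed.

(** Small enough that [D / (1 + eps)] is still at least [N = D - 1], so that the two normal scales
    differ by at most [y]; with margin [x / 10] the tail term [eps / (x / 10)^2] becomes exactly
    [x^3]. *)
Let eps : R := D^-1 / 100.
Let iD0 : 0 < D^-1. Proof. by rewrite invr_gt0; have := D512; lra. Qed.
Let eps0 : 0 < eps. Proof. by rewrite /eps; have := iD0; lra. Qed.
Let c := Num.sqrt D / Num.sqrt (1 + eps).
Let se1 : 1 <= Num.sqrt (1 + eps).
Proof. by rewrite -[leLHS]sqrtr1 ler_wsqrtr// lerDl ltW. Qed.
Let se0 : 0 < Num.sqrt (1 + eps). Proof. exact: lt_le_trans se1. Qed.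

Let c_ge : Num.sqrt N <= c.
Proof.
rewrite /c ler_pdivlMr// -sqrtrM; last by rewrite ND; have := D512; lra.
rewrite ler_wsqrtr// ND /eps.
have Dn : D != 0 by rewrite gt_eqF//; have := D512; lra.
rewrite mulrDr mulr1 (_ : (D - 1) * (D^-1 / 100) = 100^-1 - D^-1 / 100); last by field.
by have := eps0; rewrite /eps; lra.
Qed.

Let c_le : c <= Num.sqrt N + y.
Proof.
apply: (@le_trans _ _ (Num.sqrt D)).
  by rewrite /c ler_pdivrMr// ler_peMr// ltW.
rewrite -lerBlDl /y -(ler_pM2r sD0) mulVf ?gt_eqF//.
have h : Num.sqrt N <= Num.sqrt D by rewrite ler_wsqrtr// ND; lra.
have h2 := ler_wpM2l (ltW sN0) h.
have e1 : Num.sqrt D * Num.sqrt D = D by rewrite -expr2 sD2.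
have e2 : Num.sqrt N * Num.sqrt N = N by rewrite -expr2 sN2.
rewrite mulrBl e1; rewrite e2 in h2; have := ND; lra.
Qed.

Let pk := normal_peak_le R.

Let Phi_diff (a b e : R) : a <= b -> b - a <= e -> Phi b <= Phi a + 43 / 100 * e.
Proof.
move=> ab be; have := Phi_lip ab.
have : normal_peak 1 * (b - a) <= 43 / 100 * (b - a) by rewrite ler_wpM2r// subr_ge0.
lra.
Qed.

Let Phi_scale (t : R) : -1 <= t <= 1 ->
  `|Phi (c * t) - Phi (Num.sqrt N * t)| <= 43 / 100 * y.
Proof.
move=> /andP[t1 t2]; rewrite ler_norml; apply/andP; split.
- have [t0|t0] := leP 0 t.
    have h : Phi (Num.sqrt N * t) <= Phi (c * t) by apply: Phi_homo; rewrite ler_wpM2r.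
    by have := y0; lra.
  have h : c * t <= Num.sqrt N * t by rewrite ler_wnM2r// ltW.
  have := @Phi_diff _ _ y h; rewrite -mulrBl => H.
  suff : (Num.sqrt N - c) * t <= y by move=> /H; lra.
  have := c_ge; have := c_le; move: (Num.sqrt N) => s *; nra.
- have [t0|t0] := leP 0 t; last first.
    have h : Phi (c * t) <= Phi (Num.sqrt N * t) by apply: Phi_homo; rewrite ler_wnM2r// ltW.
    by have := y0; lra.
  have h : Num.sqrt N * t <= c * t by rewrite ler_wpM2r.
  have := @Phi_diff _ _ y h; rewrite -mulrBl => H.
  suff : (c - Num.sqrt N) * t <= y by move=> /H; lra.
  have := c_ge; have := c_le; move: (Num.sqrt N) => s *; nra.
Qed.

Let ratio (t : R) := (semicircle_prim n t - semicircle_prim n (-1)) / semicircle_mass R n.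

Let ratio_near (t : R) : -1 <= t <= 1 -> `|ratio t - Phi (Num.sqrt N * t)| <= 4 / N.
Proof. by move=> t1; apply: semicircle_gauss => //; apply: leq_trans n511. Qed.

Let N4 : 4 / N <= 3 / 100 * x.
Proof.
have N0 : 0 < N by rewrite ND; have := D512; lra.
have h : N^-1 <= 100 / 99 * D^-1.
  rewrite -[100 / 99](invf_div 99 100) -invfM; apply: ler_inv; last by rewrite ND; have := D512; lra.
  by have := D512; lra.
rewrite DV in h.
have e4 : (29 / 100) ^+ 4 <= 1 / 139 :> R by lra.
have x4 : x ^+ 4 <= 1 / 139.
  by apply: le_trans e4; rewrite lerXn2r ?nnegrE ?(ltW x0).
have h5 : x ^+ 5 <= 1 / 139 * x by rewrite exprSr ler_wpM2r ?(ltW x0).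
have := x0; lra.
Qed.

Let gap : 2 / (n%:R * semicircle_mass R n) <= 167 / 1000 * x.
Proof.
apply: le_trans (ratio_gap n511) _; rewrite -/N.
have h : (Num.sqrt N)^-1 <= 101 / 100 * y.
  rewrite /y -[101 / 100](invf_div 100 101) -invfM; apply: ler_inv.
    by have := sD0; lra.
  have h0 : 0 <= 100 / 101 * Num.sqrt D by have := sD0; lra.
  rewrite -(@ler_pXn2r _ 2)// ?nnegrE ?(ltW sN0)//.
  by rewrite exprMn sD2 sN2 ND; have := D512; lra.
have := y_le; have := x0; lra.
Qed.

Let xn : x != 0. Proof. by rewrite gt_eqF. Qed.

Let fourth : 3 / (4 * D * x ^+ 4) = 3 / 4 * x.
Proof.
have -> : D = (x ^+ 5)^-1 by rewrite -DV invrK.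
by field.
Qed.

Let tail : eps / (x / 10) ^+ 2 <= 17 / 200 * x.
Proof.
rewrite /eps DV (_ : x ^+ 5 / 100 / (x / 10) ^+ 2 = x ^+ 3); last by field.
have : x ^+ 2 <= (29 / 100) ^+ 2 by rewrite lerXn2r ?nnegrE ?(ltW x0).
rewrite exprS => h; have := ler_wpM2l (ltW x0) h; have := x0; lra.
Qed.

Let shift_le (a b : R) : 0 <= b -> Phi ((a + b) / Num.sqrt (1 + eps)) <=
  Phi (a / Num.sqrt (1 + eps)) + 43 / 100 * b.
Proof.
move=> b0; apply: Phi_diff; first by rewrite ler_pM2r ?invr_gt0// lerDl.
rewrite -mulrBl addrC addKr ler_pdivrMr// ler_peMr//.
Qed.

(** With [w = x] and margin [x / 10] the errors, in units of [x], are at most: 0.75 for the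
    replacement, 0.43 times 4.1 for the shift, 0.085 for the tail, 0.069 for the change of scale and
    0.03 for the spherical density; together less than 2.7. *)
Let cdf_T_near (t : R) : -1 <= t <= 1 -> `|cdf_T u k t - ratio t| <= 270 / 100 * x.
Proof.
move=> t1; have w10 : 0 < x / 10 by rewrite divr_gt0.
have up := @cdf_T_le R m u hu k x (x / 10) eps x0 w10 eps0 t.
have lo := @cdf_T_ge R m u hu k x (x / 10) eps x0 w10 eps0 t.
rewrite fourth in up lo.
have b0 : 0 <= x / 10 + 4 * x by have := x0; lra.
have s1 := shift_le (Num.sqrt D * t) b0.
have s2 := shift_le (Num.sqrt D * t - x / 10 - 4 * x) b0.
rewrite addrA in s1.
rewrite (_ : Num.sqrt D * t - x / 10 - 4 * x + (x / 10 + 4 * x) = Num.sqrt D * t) in s2; last by ring.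
rewrite (mulrAC (Num.sqrt D)) -/c in s1 s2.
have := Phi_scale t1; have := ratio_near t1; rewrite !ler_norml => /andP[r1 r2] /andP[p1 p2].
have := y_le; have := N4; have := tail.
by move=> *; apply/andP; split; lra.
Qed.

Lemma cdf_dist_large (t : R) : `|cdf_T u k t - cdf_X k t| <= 3 * x.
Proof.
have d2 : (2 <= d)%N by apply: leq_trans d512.
have dodd : ~~ odd d by rewrite oddX negb_or; case: (m) m9.
have near (s : R) : -1 <= s <= 1 -> `|cdf_X k s - ratio s| <= 167 / 1000 * x.
  by move=> s1; apply: le_trans gap; exact: cdf_X_near_dim.
(* Beyond the endpoints monotonicity suffices: for [t >= 1] the value of [cdf_T] lies between its
   value at 1 and 1, where [ratio] equals 1; for [t < -1] it lies between 0 and its value at -1,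
   where [ratio] is 0. *)
have [t1|t1] := leP 1 t.
  have o1 : (-1 : R) <= (1 : R) <= 1 by apply/andP; split; lra.
  have := cdf_T_near o1; have := near _ o1; rewrite (cdf_X_gt1 k t1).
  have := cdf_T_homo u k t1; have := cdf_T_le1 u k t; have := cdf_X_le1_dim k 1 d2.
  have -> : ratio 1 = 1 by rewrite /ratio divff// gt_eqF// semicircle_mass_gt0.
  by rewrite !ler_norml => *; apply/andP; split; have := x0; lra.
have [t2|t2] := ltP t (-1).
  have o1 : (-1 : R) <= (-1 : R) <= 1 by apply/andP; split; lra.
  have := cdf_T_near o1; rewrite (cdf_X_ltN1 k t2).
  have := cdf_T_homo u k (ltW t2); have := cdf_T_ge0 u k t.
  have -> : ratio (-1) = 0 by rewrite /ratio subrr mul0r.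
  by rewrite !ler_norml => *; apply/andP; split; have := x0; lra.
have o1 : -1 <= t <= 1 by rewrite t2 ltW.
have := cdf_T_near o1; have := near _ o1.
by rewrite !ler_norml => *; apply/andP; split; have := x0; lra.
Qed.

End large_dimension.

Lemma kolmogorov_le (F G : R -> R) (b : R) :
  (forall t, `|F t - G t| <= b) -> kolmogorov F G <= b.
Proof.
move=> FG; apply: ge_sup; first by exists `|F 0 - G 0|, 0.
by move=> _ [t _ <-].
Qed.

End numerics.

Unset Implicit Arguments.
Set Strict Implicit.
Local Close Scope classical_set_scope.

Theorem mainTheorem2 (R : realType) (m : nat) (hm : (1 <= m)%N)
    (u : 'cV[R]_(2 ^ m)) (hu : on_sphere u) (k : 'I_(2 ^ m)) :
  kolmogorov (cdf_T u k) (@cdf_X R (2 ^ m) k)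
    <= C_pos R * powR ((2 ^ m)%:R) (- (1 / 5)).
Proof.
set x := powR _ _; have D0 : 0 < (2 ^ m)%:R :> R by rewrite ltr0n expn_gt0.
have x0 : 0 < x by rewrite powR_gt0.
have x5 : x ^+ 5 * (2 ^ m)%:R = 1.
  rewrite powR_exp (_ : _ * 5%:R = -1); last by field.
  by rewrite powR_inv1 ?ltW// mulVf// gt_eqF.
have C3 := C_pos_ge R.
apply: kolmogorov_le => t.
have [m8|m9] := leqP m 8; last first.
  apply: le_trans (cdf_dist_large k hu m9 x0 x5 t) _.
  by rewrite ler_wpM2r ?ltW//; lra.
apply: (@le_trans _ _ 1).
  have d2 : (2 <= 2 ^ m)%N by rewrite (leq_pexp2l (m := 2) (n1 := 1)).
  have := cdf_X_le1_dim k t d2; have := cdf_X_ge0 k t.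
  have := cdf_T_le1 u k t; have := cdf_T_ge0 u k t.
  by move=> *; rewrite ler_norml; apply/andP; split; lra.
(* For [d <= 256] one has [x >= 256^(-1/5)], about 0.33, and 0.31 is already enough because 3.3
   times 0.31 exceeds 1. *)
have x31 : 31 / 100 <= x.
  rewrite leNgt; apply/negP => xx.
  have h1 : x ^+ 5 <= (31 / 100) ^+ 5 by rewrite lerXn2r ?nnegrE ?(ltW x0)//; lra.
  have h2 : (2 ^ m)%:R <= 256 :> R by rewrite (ler_nat R _ 256) (leq_pexp2l (m := 2) (n2 := 8)).
  have : x ^+ 5 * (2 ^ m)%:R <= (31 / 100) ^+ 5 * 256.
    by rewrite ler_pM// ?exprn_ge0// ltW.
  by rewrite x5; lra.
have := ler_wpM2r (ltW x0) C3; lra.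
Qed.
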